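(* Let $d\ge1$. There are positive constants $\tilde c(d)$ and $C(d)$, depending only on $d$, such that the following holds. Let $0\leq\eta\leq\tilde c(d)$ and let $\{f^{(Q)}\}_{Q\in\mathcal{D}_d}$ be any $SNBV$ family (that is, $f^{(Q)}\in SNBV(Q)$ for every $Q\in\mathcal{D}_d$). Suppose that, for every $Q\in\mathcal{D}_d$, there is a real $d\times d$ matrix $A^{(Q)}$ and a vector $y^{(Q)}\in\mathbf{R}^d$ such that $$\Vert A^{(Q)}-I_d\Vert_\infty+\Vert y^{(Q)}\Vert_\infty\leq\eta.$$ For every $Q\in\mathcal{D}_d$ define $$\widetilde{f^{(Q)}}(x):=f^{(Q)}\bigl(x_Q+A^{(Q)}(\ell(Q)y^{(Q)}+x-x_Q)\bigr).$$ Then $$\left\Vert\left\{\frac{f^{(Q)}-|A^{(Q)}|\,\widetilde{f^{(Q)}}}{|Q|^{1/2}}\right\}_{Q\in\mathcal{D}_d}\right\Vert_{AO(\mathcal{D}_d)}\leq C(d)\,\eta^{1/2}.$$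
   Context: Bessel families: a family $\{\psi_\gamma\}_{\gamma\in\Gamma}\subset L^2(\mathbf{R}^d)$ is a Bessel family if there is $0\le B<\infty$ with $\sum_{\gamma\in\Gamma}|\langle f,\psi_\gamma\rangle|^2\leq B\Vert f\Vert_2^2$ for all $f\in L^2(\mathbf{R}^d)$, where $\langle f,g\rangle=\int f\overline{g}\,dx$; the minimal such $B$ is the optimal bound. $AO(\Gamma)$ is the vector space of Bessel families indexed by $\Gamma$, and $\Vert\{\psi_\gamma\}_{\gamma\in\Gamma}\Vert_{AO(\Gamma)}$ is the square root of the optimal bound. A bound on the $AO(\Gamma)$ norm includes the assertion that the family is Bessel. Dyadic cubes: a dyadic interval is an interval $[j2^n,(j+1)2^n)$ with $j,n$ integers. A cube $Q\subset\mathbf{R}^d$ is a product of $d$ half-open intervals $[a,b)$ of the same length $\ell(Q)$; $x_Q$ is its center and $|Q|$ its Lebesgue measure. $Q$ is dyadic if all its factors are dyadic; $\mathcal{D}_d$ is the set of dyadic cubes in $\mathbf{R}^d$. $SNBV$: a measurable $f:\mathbf{R}^d\to\mathbf{C}$ belongs to $SNBV(\mathbf{R}^d)$ if, for every pair $(v,y)\in\mathbf{R}^d\times\mathbf{R}^d$, the function $t\mapsto f(y+tv)$ on $\mathbf{R}$ is of bounded variation with total variation $\leq1$. For a cube $Q$, $f\in SNBV(Q)$ if $f\in SNBV(\mathbf{R}^d)$ and $\{x:f(x)\neq0\}\subset Q$. No cancellation $\int f\,dx=0$ is required. Norms: for a real $d\times l$ matrix $B=[b_{ij}]$, $\Vert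 B\Vert_\infty:=\max_{1\le i\le d}\sum_{j=1}^l|b_{ij}|$; for a (column) vector, $\Vert x\Vert_\infty=\max_i|x_i|$. $I_d$ is the $d\times d$ identity. For a square matrix $A$, $|A|$ denotes the determinant of $A$. *)

(* Defs.v *)
From HB Require Import structures.
From mathcomp Require Import all_boot all_order all_algebra.
From mathcomp Require Import complex.
From mathcomp Require Import all_classical all_reals all_analysis.

Set Implicit Arguments.
Unset Strict Implicit.
Unset Printing Implicit Defensive.

Import Order.TTheory GRing.Theory Num.Theory.
Import numFieldNormedType.Exports.
Import ComplexField.Normc.

Local Open Scope classical_set_scope.
Local Open Scope ring_scope.
Local Open Scope complex_scope.

(* ['cV[T]_n] carries the product sigma-algebra, generated by the coordinates. *)
Definition measure_colvec_display : measure_display -> measure_display.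
Proof. exact. Qed.

Section measurable_colvec.
Context {d : measure_display} {T : measurableType d}.
Variable n : nat.

Let coors : 'I_n -> 'cV[T]_n -> T := fun i x => x i ord0.

Let colvec_set0 : g_sigma_preimage coors set0.
Proof. exact: sigma_algebra0. Qed.

Let colvec_setC A : g_sigma_preimage coors A -> g_sigma_preimage coors (~` A).
Proof. exact: sigma_algebraC. Qed.

Let colvec_bigcup (F : _^nat) : (forall i, g_sigma_preimage coors (F i)) ->
  g_sigma_preimage coors (\bigcup_i (F i)).
Proof. exact: sigma_algebra_bigcup. Qed.

HB.instance Definition _ := @isMeasurable.Build (measure_colvec_display d)
  'cV[T]_n (g_sigma_preimage coors) colvec_set0 colvec_setC colvec_bigcup.

End measurable_colvec.

Section colvec_cons.
Context {R : realType}.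
Variable n : nat.

Definition colvec_cons (p : R * 'cV[R]_n) : 'cV[R]_n.+1 :=
  col_mx p.1%:M p.2.

Definition colvec_uncons (x : 'cV[R]_n.+1) : R * 'cV[R]_n :=
  (x ord0 ord0, dsubmx (x : 'cV[R]_(1 + n))).

Lemma colvec_unconsK : cancel colvec_uncons colvec_cons.
Proof.
move=> x; rewrite /colvec_cons /colvec_uncons /= -[RHS](@vsubmxK _ 1).
rewrite (_ : usubmx _ = (x ord0 ord0)%:M)// [LHS]mx11_scalar mxE; congr (x _ _)%:M.
exact/val_inj.
Qed.

Lemma colvec_consK : cancel colvec_cons colvec_uncons.
Proof.
move=> [a v]; rewrite /colvec_cons /colvec_uncons; congr pair.
  rewrite (_ : ord0 = @lshift 1 n ord0); last exact/val_inj.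
  by rewrite (@col_mxEu _ 1) mxE.
exact: (@col_mxKd _ 1).
Qed.

Lemma measurable_coord m (i : 'I_m) :
  measurable_fun [set: 'cV[R]_m] (fun x => x i ord0).
Proof.
move=> _ Y mY; rewrite setTI; apply: sub_sigma_algebra => /=.
rewrite -bigcup_seq/=; exists i => /=; first by rewrite mem_index_enum.
by exists Y => //; rewrite setTI.
Qed.

Lemma measurable_fun_colvecP d (T : measurableType d) m (f : T -> 'cV[R]_m) :
  (forall i, measurable_fun [set: T] (fun t => f t i ord0)) ->
  measurable_fun [set: T] f.
Proof.
move=> mf _ A mA.
have : (g_sigma_preimage (fun (i : 'I_m) t => f t i ord0)) (f @^-1` A).
  rewrite (g_sigma_preimage_comp (fun (i : 'I_m) (x : 'cV[R]_m) => x i ord0) f).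
  by exists A => //; rewrite setTI.
rewrite setTI; apply: smallest_sub; first exact: sigma_algebra_measurable.
move=> B; rewrite -bigcup_seq/= => -[i _ [C mC <-]].
exact: mf.
Qed.

Lemma measurable_colvec_cons : measurable_fun setT colvec_cons.
Proof.
apply: measurable_fun_colvecP => i.
rewrite /colvec_cons.
case: (@split_ordP 1 n i) => j ->.
- under eq_fun do rewrite (@col_mxEu _ 1) mxE.
  rewrite ord1 eqxx; exact: measurable_fst.
- under eq_fun do rewrite (@col_mxEd _ 1).
  by apply: (measurableT_comp (measurable_coord j)); exact: measurable_snd.
Qed.

Lemma measurable_colvec_uncons : measurable_fun setT colvec_uncons.
Proof.
apply/measurable_fun_pairP; split; first exact: measurable_coord.
apply: measurable_fun_colvecP => i /=.
under eq_fun do rewrite mxE.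
exact: measurable_coord.
Qed.

End colvec_cons.

Section borel_lebesgue_step.
Context {R : realType}.
Variable n : nat.
Variable m : {sigma_finite_measure set 'cV[R]_n -> \bar R}.

Definition borel_lebesgue_step : set 'cV[R]_n.+1 -> \bar R :=
  pushforward (@lebesgue_measure R \x m)%E (@colvec_cons R n).

Let mcons : measurable_fun setT
  (@colvec_cons R n : measurableTypeR R * 'cV[R]_n -> 'cV[R]_n.+1).
Proof. exact: measurable_colvec_cons. Qed.

Let step0 : borel_lebesgue_step set0 = 0%E.
Proof. by rewrite /borel_lebesgue_step /pushforward preimage_set0 measure0. Qed.

Let step_ge0 A : (0 <= borel_lebesgue_step A)%E.
Proof. exact: measure_ge0. Qed.

Let step_sigma_additive : semi_sigma_additive borel_lebesgue_step.
Proof.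
move=> F mF tF mUF; rewrite /borel_lebesgue_step /pushforward preimage_bigcup.
apply: measure_semi_sigma_additive.
- by move=> k; rewrite -[X in measurable X]setTI; exact: mcons.
- apply/trivIsetP => /= i j _ _ ij; rewrite -preimage_setI.
  by move/trivIsetP : tF => /(_ _ _ _ _ ij) ->//; rewrite preimage_set0.
- by rewrite -preimage_bigcup -[X in measurable X]setTI; exact: mcons.
Qed.

HB.instance Definition _ := isMeasure.Build _ _ _ borel_lebesgue_step
  step0 step_ge0 step_sigma_additive.

Let step_sigma_finite : sigma_finite setT borel_lebesgue_step.
Proof.
have /sigma_finiteP[F [FT ndF Foo]] := sigma_finiteT (@lebesgue_measure R).
have /sigma_finiteP[G [GT ndG Goo]] := sigma_finiteT m.
exists (fun k => @colvec_uncons R n @^-1` (F k `*` G k)).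
  rewrite -preimage_bigcup (_ : \bigcup_k _ = setT) ?preimage_setT//.
  rewrite -setXTT FT GT predeqE => -[x y]; split.
    by move=> [k _ []]; split; exists k.
  move=> [/= [k _ Fkx] [l _ Gly]]; exists (maxn k l) => //; split.
  - by move: x Fkx; exact/subsetPset/ndF/leq_maxl.
  - by move: y Gly; exact/subsetPset/ndG/leq_maxr.
move=> k; have [mF Fkoo] := Foo k; have [mG Gkoo] := Goo k; split.
  rewrite -[X in measurable X]setTI; apply: measurable_colvec_uncons => //.
  exact: measurableX.
rewrite /borel_lebesgue_step /pushforward -comp_preimage.
rewrite (_ : _ \o _ = id); last by apply/funext => p; exact: colvec_consK.
by rewrite preimage_id product_measure1E// lte_mul_pinfty// ge0_fin_numE.
Qed.

HB.instance Definition _ := Measure_isSigmaFinite.Build _ _ _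
  borel_lebesgue_step step_sigma_finite.

End borel_lebesgue_step.

(* [n]-fold product of the one-dimensional Lebesgue measure on Borel sets *)
Fixpoint borel_lebesgue (R : realType) (n : nat) :
    {sigma_finite_measure set 'cV[R]_n -> \bar R} :=
  if n is n'.+1 then borel_lebesgue_step (borel_lebesgue R n')
  else dirac (0 : 'cV[R]_0).

(* Carathéodory completion of [borel_lebesgue]: [lebesgue_space R n] is the type
   ['cV[R]_n] equipped with the sigma-algebra of Lebesgue measurable sets. *)
Definition lebesgue_space (R : realType) (n : nat) : Type :=
  caratheodory_type ((borel_lebesgue R n)^*)%mu.

HB.instance Definition _ (R : realType) (n : nat) :=
  Measurable.on (lebesgue_space R n).

Definition lebesgue (R : realType) (n : nat) :
    set (lebesgue_space R n) -> \bar R :=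
  @completed_measure_extension _ _ _ (borel_lebesgue R n).

HB.instance Definition _ (R : realType) (n : nat) :=
  Measure.on (@lebesgue R n).

Section L2.
Context {R : realType} {d : nat}.
Implicit Types f g : 'cV[R]_d -> R[i].

Definition Lmeasurable f :=
  measurable_fun [set: lebesgue_space R d] (fun x => complex.Re (f x)) /\
  measurable_fun [set: lebesgue_space R d] (fun x => complex.Im (f x)).

(* The default value of [Rintegral] plays no role below: the product of two
   square-integrable functions is integrable. *)
Definition cintegral f : R[i] :=
  (\int[@lebesgue R d]_x complex.Re (f x)) +i*
  (\int[@lebesgue R d]_x complex.Im (f x)).

Definition L2norm f : \bar R :=
  ('N[@lebesgue R d]_(2%:E)[EFin \o @normc R \o f])%E.

Definition L2 : set ('cV[R]_d -> R[i]) :=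
  [set f | Lmeasurable f /\ (L2norm f < +oo)%E].

Definition inner f g : R[i] := cintegral (fun x => f x * conjc (g x)).

End L2.

Section Bessel.
Context {R : realType} {d : nat} {I : choiceType}.
Variables (G : set I) (psi : I -> 'cV[R]_d -> R[i]).

Definition bessel_bound (B : R) :=
  0 <= B /\ forall f, L2 f ->
    (\esum_(g in G) ((normc (inner f (psi g))) ^+ 2)%:E
      <= B%:E * L2norm f ^+ 2)%E.

Definition bessel :=
  (forall g, G g -> L2 (psi g)) /\ exists B, bessel_bound B.

Definition AO_norm : R := Num.sqrt (inf [set B | bessel_bound B]).

End Bessel.

Section cubes.
Context {R : realType} {d : nat}.

(* The cube with lower corner [a] and side length [l] is encoded as [(a, l)]. *)
Definition cube : Type := ('cV[R]_d * R)%type.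
HB.instance Definition _ := Choice.on cube.

Implicit Types Q : cube.

Definition corner Q : 'cV[R]_d := Q.1.
Definition side Q : R := Q.2.

Definition cube_set Q : set 'cV[R]_d :=
  [set x | forall i, x i ord0 \in `[corner Q i ord0, corner Q i ord0 + side Q[].

Definition center Q : 'cV[R]_d := corner Q + const_mx (side Q / 2).

Definition volume Q : R := fine (@lebesgue R d (cube_set Q)).

(* endpoints [a], [b] of a dyadic interval [a, b) *)
Definition dyadic_interval (a b : R) :=
  exists j n : int, a = j%:~R * 2 ^ n /\ b = (j + 1)%:~R * 2 ^ n.

(* Positivity of [side Q] follows when [0 < d]. *)
Definition dyadic : set cube :=
  [set Q | forall i, dyadic_interval (corner Q i ord0)
                                     (corner Q i ord0 + side Q)].

End cubes.
Arguments cube : clear implicits.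

Section SNBV.
Context {R : realType} {d : nat}.

(* total variation over the whole real line of a complex-valued function *)
Definition total_variationC (h : R -> R[i]) : \bar R :=
  ereal_sup [set (\sum_(0 <= k < (size s).-1) normc (h s`_k.+1 - h s`_k))%:E
            | s in [set s : seq R | sorted <%R s]].

Definition SNBV : set ('cV[R]_d -> R[i]) :=
  [set f | Lmeasurable f /\
    forall v y : 'cV[R]_d, (total_variationC (fun t => f (y + t *: v)%R) <= 1)%E].

Definition SNBV_on (Q : cube R d) : set ('cV[R]_d -> R[i]) :=
  [set f | SNBV f /\ [set x | f x != 0] `<=` cube_set Q].

End SNBV.

(* For vectors the max norm is the library norm [`|x|]. *)
Definition mx_norm_inf (R : realType) (m n : nat) (B : 'M[R]_(m, n)) : R :=
  \big[Num.max/0]_(i < m) \sum_(j < n) `|B i j|.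

Definition tilde (R : realType) (d : nat) (Q : cube R d) (A : 'M[R]_d)
    (y : 'cV[R]_d) (f : 'cV[R]_d -> R[i]) : 'cV[R]_d -> R[i] :=
  fun x => f (center Q + A *m (side Q *: y + x - center Q)).

(* Main.v *)
(** Write [F - det A F o T] as a telescoping sum over the factors of the
    affine map [T], each factor changing a single coordinate of its argument.
    For one factor the difference is, on every line in the direction of that
    coordinate, a function [G] of bounded variation with [\int G = 0] and
    [\int |G| <= C eta l(Q)].  In dimension one such functions are almost
    orthogonal: if [l(Q') <= l(Q)] then
    [|\int G_Q G_Q'| <= osc_{Q'}(G_Q) \int |G_Q'|], and the oscillations of
    [G_Q] over the cubes of one scale add up to a multiple of its variation.
    Integrating over the parallel lines bounds the weighted row sums of the
    Gram matrix by [C eta], so that Schur's test yields the Bessel bound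
    [C eta].  (Working on lines is essential: in dimension at least 2 the
    essential oscillations over subcubes need not be summable.) *)

Require Import Defs.
From mathcomp Require Import all_boot all_order all_algebra finmap.
From mathcomp Require Import complex.
From mathcomp Require Import all_classical all_reals all_analysis.
From mathcomp Require Import measurable_realfun ring lra zify.

Set Implicit Arguments.
Unset Strict Implicit.
Unset Printing Implicit Defensive.

Import Order.TTheory GRing.Theory Num.Theory.
Import numFieldNormedType.Exports.
Import ComplexField.Normc.

Local Open Scope classical_set_scope.
Local Open Scope ring_scope.
Local Open Scope complex_scope.

(** * Functions of bounded variation on the line *)

(** A factor that changes only the coordinate [m] maps every line in direction [m] to itself by
    [t |-> A m m * t + b]. Multiplying by its determinant [A m m] therefore gives mean zero on each
    such line separately; a general affine map does not preserve these lines. On a line only the L1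
    norm is small, of order [eta * l(Q)], while the variation stays of order 1. A pairing uses the
    variation of one function and the L1 norm of the other, hence a single factor [eta] in the
    Bessel bound and its square root in the norm. Two obstacles shape the rest. Contributions of all
    cubes of one scale near a line must be added over overlapping windows: every factor, even the
    mere proximity of two cubes, is written as an increment of a bounded nondecreasing function at
    equally spaced points, so that the sums telescope. And the functions are only Lebesgue
    measurable: Fubini and composition with affine maps go through Borel modifications off null
    sets, while integrability on every single line comes from bounded variation. *)

Section dominated.
Context {R : realType}.
Implicit Types (v F : R -> R) (V : R).

(* [v] stands for the variation of [F] on the half-lines ]-oo, t]. *)
Definition dominates V v F :=
  [/\ forall x y, x <= y -> `|F y - F x| <= v y - v x,
      forall x, 0 <= v x & forall x, v x <= V].

Lemma dominates_nondecreasing V v F : dominates V v F -> nondecreasing_fun v.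
Proof. by move=> [vF _ _] x y /vF xy; rewrite -subr_ge0 (le_trans _ xy). Qed.

Lemma dominates_dist V v F x y : dominates V v F -> `|F x - F y| <= V.
Proof.
move=> [vF v0 vV]; wlog xy : x y / x <= y.
  by move=> H; case: (leP x y) => [/H//|/ltW/H]; rewrite distrC.
rewrite distrC (le_trans (vF _ _ xy))// lerBlDr (le_trans (vV y))//.
by rewrite lerDl.
Qed.

Lemma dominates_normr V v F z : dominates V v F -> F z = 0 ->
  forall x, `|F x| <= V.
Proof. by move=> vF Fz x; rewrite -(subr0 (F x)) -Fz; exact: dominates_dist vF. Qed.

Lemma dominatesB V v F V' v' F' : dominates V v F -> dominates V' v' F' ->
  dominates (V + V') (v \+ v') (F \- F').
Proof.
move=> [vF v0 vV] [vF' v0' vV']; split => [x y xy|x|x] /=.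
- rewrite (_ : F y - _ - _ = (F y - F x) - (F' y - F' x)); last by ring.
  rewrite (_ : v y + _ - _ = (v y - v x) + (v' y - v' x)); last by ring.
  by rewrite (le_trans (ler_normB _ _))// lerD ?vF ?vF'.
- by rewrite addr_ge0.
- by rewrite lerD.
Qed.

Lemma dominatesZ a V v F : dominates V v F ->
  dominates (`|a| * V) (fun x => `|a| * v x) (fun x => a * F x).
Proof.
move=> [vF v0 vV]; split => [x y xy|x|x].
- by rewrite -!mulrBr normrM ler_wpM2l ?vF.
- by rewrite mulr_ge0.
- by rewrite ler_wpM2l.
Qed.

Lemma dominates_comp V v F (phi : R -> R) : nondecreasing_fun phi ->
  dominates V v F -> dominates V (v \o phi) (F \o phi).
Proof. by move=> phi_nd [vF v0 vV]; split => //= x y /phi_nd /vF. Qed.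

(** A step function is its own variation function. Its increment across a window is [V] when [x0]
    lies in the window and 0 otherwise, so that proximity to [x0] can be counted like variation. *)
Lemma dominates_step (x0 V : R) : 0 <= V ->
  dominates V (fun t => V * (x0 <= t)%R%:R) (fun t => V * (x0 <= t)%R%:R).
Proof.
move=> V0; split => [x y xy|x|x].
- rewrite ger0_norm// -mulrBr mulr_ge0// subr_ge0 ler_nat.
  by case: (leP x0 x) => // /le_trans /(_ xy) ->.
- by rewrite mulr_ge0.
- by rewrite ler_piMr// lern1 leq_b1.
Qed.

(** Jordan decomposition: [v] and [v \- F] are both nondecreasing. *)
Lemma dominates_measurable V v F : dominates V v F -> measurable_fun setT F.
Proof.
move=> vF; have vnd := dominates_nondecreasing vF; case: vF => vF _ _.
rewrite (_ : F = v \- (v \- F)); last by apply/funext => x /=; rewrite opprB addrC subrK.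
apply: measurable_funB; first exact: nondecreasing_measurable.
apply: nondecreasing_measurable => // x y xy /=.
rewrite lerBrDr addrAC -addrA -lerBrDl.
by apply: le_trans (vF _ _ xy); rewrite ler_norm.
Qed.

End dominated.

(** * Telescoping counts and geometric series *)

Section combinatorics.
Context {R : realType}.

(** Induction on [K]: raising the shift by one adds the differences [u (q.+1 + K) - u (q + K)],
    which telescope to a single increment of [u], at most [V]. *)
Lemma sum_telescope_le (u : nat -> R) (V : R) (K M : nat) :
  {homo u : n m / (n <= m)%N >-> n <= m} -> (forall n, 0 <= u n <= V) ->
  \sum_(q < M) (u (q + K)%N - u q) <= K%:R * V.
Proof.
move=> und uV; elim: K => [|K IH].
  by rewrite mul0r big1// => q _; rewrite addn0 subrr.
rewrite -natr1 mulrDl mul1r.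
rewrite (eq_bigr (fun q : 'I_M => (u (q + K)%N - u q) +
  (u (q.+1 + K)%N - u (q + K)%N))); last first.
  by move=> q _; rewrite addnS addSn; ring.
rewrite big_split/= lerD//.
rewrite -(big_mkord xpredT (fun q => u (q.+1 + K)%N - u (q + K)%N)).
rewrite (telescope_sumr (fun q => u (q + K)%N))// add0n.
by have /andP[_ ?] := uV (M + K)%N; have /andP[? _] := uV K; lra.
Qed.

(** Windows of half-width [K * delta] around points [delta] apart overlap at most [2 * K] times;
    sampled at the left end points, each window is a shift by [2 * K] steps. *)
Lemma count_centers (v : R -> R) (V delta x0 : R) (K M : nat) :
  nondecreasing_fun v -> (forall x, 0 <= v x <= V) -> 0 <= delta ->
  \sum_(q < M) (v (x0 + q%:R * delta + K%:R * delta) -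
                v (x0 + q%:R * delta - K%:R * delta)) <= (2 * K)%:R * V.
Proof.
move=> vnd vV d0.
pose u n := v (x0 + n%:R * delta - K%:R * delta).
rewrite (eq_bigr (fun q : 'I_M => u (q + 2 * K)%N - u q)); last first.
  move=> q _; rewrite /u; congr (v _ - _).
  by rewrite natrD natrM; ring.
apply: sum_telescope_le => [n m nm|n]; last exact: vV.
by apply: vnd; rewrite lerD2r lerD2l ler_wpM2r// ler_nat.
Qed.

(* The product structure of the grid of centers turns the sum over a whole
   scale into a product of one-dimensional telescoping sums. *)
Lemma count_grid (d M K : nat) (v : 'I_d -> R -> R) (V delta x0 : R) :
  (forall m, nondecreasing_fun (v m)) -> (forall m x, 0 <= v m x <= V) ->
  0 <= delta ->
  \sum_(q : {ffun 'I_d -> 'I_M})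
    \prod_m (v m (x0 + (q m)%:R * delta + K%:R * delta) -
             v m (x0 + (q m)%:R * delta - K%:R * delta)) <=
  ((2 * K)%:R * V) ^+ d.
Proof.
move=> vnd vV d0.
rewrite -(bigA_distr_bigA (fun m (q : 'I_M) =>
  v m (x0 + q%:R * delta + K%:R * delta) -
  v m (x0 + q%:R * delta - K%:R * delta))) /=.
have -> : ((2 * K)%:R * V) ^+ d = \prod_(m < d) ((2 * K)%:R * V).
  by rewrite prodr_const card_ord.
apply: ler_prod => m _; rewrite count_centers// andbT.
apply: sumr_ge0 => q _; rewrite subr_ge0; apply: vnd.
by rewrite lerD2l ge0_cp// mulr_ge0.
Qed.

Lemma sum_geometric_le (r : R) (M : nat) : 0 <= r < 1 ->
  \sum_(p < M) r ^+ p <= (1 - r)^-1.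
Proof.
move=> /andP[r0 r1].
rewrite -(ler_pM2l (x := 1 - r)) ?subr_gt0// mulfV ?subr_eq0 ?gt_eqF//.
rewrite -opprB mulNr -subrX1 opprB; have := exprn_ge0 M r0; lra.
Qed.

Lemma sum_two_sided_geometric_le (r : R) (M p0 : nat) : 0 <= r < 1 ->
  \sum_(p < M) r ^+ `|p - p0|%N <= 2 * (1 - r)^-1.
Proof.
move=> r01; have /andP[r0 r1] := r01.
(* The range is extended to [p0 + M] so that it splits at [p0] into two one-sided series even when
   [M <= p0]. *)
apply: (@le_trans _ _ (\sum_(p < p0 + M) r ^+ `|p - p0|%N)).
  rewrite -!(big_mkord xpredT (fun p => r ^+ `|p - p0|%N)) (addnC p0).
  rewrite [leRHS](big_cat_nat (leq0n M) (leq_addr _ _))/= lerDl.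
  by apply: sumr_ge0 => p _; rewrite exprn_ge0.
rewrite big_split_ord/= mulrDl mul1r lerD//; last first.
  rewrite (le_trans _ (sum_geometric_le M r01))// ler_sum// => p _.
  by rewrite ler_wiXn2l// ?ltW//; lia.
rewrite (reindex_inj rev_ord_inj)/= (le_trans _ (sum_geometric_le p0 r01))//.
apply: ler_sum => p _; rewrite ler_wiXn2l// ?ltW//.
by have := ltn_ord p; lia.
Qed.

End combinatorics.

(** * Variation functions of complex-valued functions *)

Section variation.
Context {R : realType}.
Implicit Types (h : R -> R[i]) (s : seq R).

Lemma normr_Re_normc (z : R[i]) : `|complex.Re z| <= normc z.
Proof.
by case: z => a b /=; rewrite -sqrtr_sqr ler_wsqrtr// lerDl sqr_ge0.
Qed.

Lemma normr_Im_normc (z : R[i]) : `|complex.Im z| <= normc z.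
Proof.
by case: z => a b /=; rewrite -sqrtr_sqr ler_wsqrtr// lerDr sqr_ge0.
Qed.

Lemma normc_ge0 (z : R[i]) : 0 <= normc z.
Proof. by rewrite (le_trans _ (normr_Re_normc z)). Qed.

Let S h s := \sum_(0 <= k < (size s).-1) normc (h s`_k.+1 - h s`_k).

Let S_rcons h s l y :
  S h (rcons (rcons s l) y) = S h (rcons s l) + normc (h y - h l).
Proof.
rewrite /S !size_rcons/= big_nat_recr//=; congr (_ + normc (h _ - h _)).
- rewrite big_nat_cond [RHS]big_nat_cond; apply: eq_bigr => k /andP[/andP[_ ks] _].
  by rewrite !(nth_rcons _ (rcons s l)) size_rcons !ltnS ks (ltnW ks).
- by rewrite nth_rcons size_rcons ltnn eqxx.
- by rewrite !nth_rcons size_rcons ltnSn ltnn eqxx.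
Qed.

(** [v t] is the supremum of the variation sums over partitions contained in the half-line up to
    [t]. Appending [y] to a partition that ends at [x] gains exactly the jump from [h x] to
    [h y]. *)
Lemma total_variationC_dominated h : (total_variationC h <= 1)%E ->
  exists v : R -> R, [/\ forall x y, x <= y -> normc (h y - h x) <= v y - v x,
    forall x, 0 <= v x & forall x, v x <= 1].
Proof.
move=> tv.
have S1 s : sorted <%R s -> S h s <= 1.
  move=> ss; rewrite -lee_fin; apply: le_trans tv.
  by apply: ereal_sup_ubound; exists s.
pose E t := [set S h s | s in [set s | sorted <%R s /\ all (<= t) s]].
have E0 t : E t 0 by exists [::]; rewrite // /S/= big_nil.
have hsE t : has_sup (E t).
  by split; [exists 0|exists 1 => _ [s [ss _] <-]; exact: S1].
exists (fun t => sup (E t)); split => [x y|x|x]; first last.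
- by apply: ge_sup; [exists 0|move=> _ [s [ss _] <-]; exact: S1].
- by apply: ub_le_sup => //; have [] := hsE x.
rewrite le_eqVlt => /predU1P[->|xy].
  by rewrite !subrr normc0.
rewrite lerBrDl -lerBrDr; apply: ge_sup; first by exists 0.
move=> _ [s [ss sx] <-]; rewrite lerBrDr.
(* A partition to the left of [x] can be made to end at [x] without decreasing its sum; this
   prepares for appending [y]. *)
have [l [sl ls lx]] : exists s', [/\ sorted <%R (rcons s' x),
    all (<= x) s' & S h s <= S h (rcons s' x)].
  case/lastP: s ss sx => [|s l] ss sx.
    by exists [::]; rewrite /S /= !big_nil.
  move: sx; rewrite all_rcons => /andP[] /=; rewrite le_eqVlt.
  move=> /predU1P[lx sx|lx sx].
    by exists s; rewrite -lx; split => //; rewrite lx.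
  exists (rcons s l); split.
  - case: s ss {sx} => [|a s]/= ss; first by rewrite andbT.
    by rewrite rcons_path last_rcons ss.
  - by rewrite all_rcons /= sx ltW.
  - by rewrite S_rcons lerDl normc_ge0.
apply: (@le_trans _ _ (S h (rcons (rcons l x) y))).
  by rewrite S_rcons lerD2r.
apply: ub_le_sup; first by have [] := hsE y.
exists (rcons (rcons l x) y) => //; split.
  case: (l) sl => [|a s']/= sl; first by rewrite xy.
  by rewrite rcons_path last_rcons sl.
rewrite !all_rcons /= lexx ltW//=.
by apply: sub_all ls => z /le_trans; apply; exact: ltW.
Qed.

Lemma total_variationC_Re h : (total_variationC h <= 1)%E ->
  exists v, dominates 1 v (fun t => complex.Re (h t)).
Proof.
move=> /total_variationC_dominated[v [vh v0 v1]]; exists v; split => // x y xy.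
by rewrite (le_trans _ (vh _ _ xy))// -raddfB normr_Re_normc.
Qed.

Lemma total_variationC_Im h : (total_variationC h <= 1)%E ->
  exists v, dominates 1 v (fun t => complex.Im (h t)).
Proof.
move=> /total_variationC_dominated[v [vh v0 v1]]; exists v; split => // x y xy.
by rewrite (le_trans _ (vh _ _ xy))// -raddfB normr_Im_normc.
Qed.

End variation.

(** * Affine changes of variable on the line *)

Section affine_line.
Context {R : realType}.
Notation mu := (@lebesgue_measure R).

Lemma measurable_affine (a b : R) :
  measurable_fun setT ((fun t : R => a * t + b) : measurableTypeR R -> measurableTypeR R).
Proof.
by apply: measurable_funD => //; exact: measurable_funM.
Qed.

(** The pushforward under the affine map, scaled by [a], agrees with Lebesgue measure on half-open
    intervals, and this determines it. *)
Lemma lebesgue_measure_affine (a b : R) (A : set (measurableTypeR R)) :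
  0 < a -> measurable A ->
  mu ((fun t => a * t + b) @^-1` A) = (a^-1%:E * mu A)%E.
Proof.
move=> a0 mA.
pose phi : measurableTypeR R -> measurableTypeR R := fun t => a * t + b.
have mphi : measurable_fun setT phi by exact: measurable_affine.
pose m : {measure set (measurableTypeR R) -> \bar R} :=
  mscale (NngNum (ltW a0)) (pushforward mu phi).
have -> : mu A = m mphi A.
  apply: lebesgue_measure_unique => // _ [[x y] _ <-] /=.
  rewrite /m /mscale /= /pushforward.
  rewrite (_ : phi @^-1` _ = `](x - b) / a, (y - b) / a]%classic); last first.
    apply/seteqP; split=> t; rewrite /phi/= !in_itv/= ltr_pdivrMr// ler_pdivlMr//;
    by rewrite ltrBlDr lerBrDr mulrC.
  rewrite !lebesgue_measure_itv/= !lte_fin ltr_pM2r ?invr_gt0// ltrD2r.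
  case: ifP => _; last by rewrite mule0.
  by rewrite -!EFinB -EFinM -mulrBl opprB addrA subrK mulrCA mulfV ?mulr1 ?gt_eqF.
by rewrite /m /mscale /= muleA -EFinM mulVf ?mul1e// gt_eqF.
Qed.

Lemma ge0_integral_affine (a b : R) (f : R -> \bar R) : 0 < a ->
  measurable_fun setT f -> (forall t, 0 <= f t)%E ->
  (\int[mu]_t f (a * t + b)%R = a^-1%:E * \int[mu]_t f t)%E.
Proof.
move=> a0 mf f0.
pose phi : measurableTypeR R -> measurableTypeR R := fun t => a * t + b.
have mphi : measurable_fun setT phi by exact: measurable_affine.
have := ge0_integral_pushforward mphi mu measurableT mf (fun t _ => f0 t).
rewrite preimage_setT => <-.
have a1 : 0 <= a^-1 by rewrite invr_ge0 ltW.
rewrite -(ge0_integral_mscale mu measurableT (NngNum a1) mf)//.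
apply: eq_measure_integral => A mA _.
exact: lebesgue_measure_affine.
Qed.

Lemma Rintegral_affine (a b : R) (f : R -> R) : 0 < a ->
  mu.-integrable setT (EFin \o f) ->
  a * \int[mu]_t f (a * t + b) = \int[mu]_t f t.
Proof.
move=> a0 intf; have mf := measurable_int _ intf.
have H g : (forall t, 0 <= g t)%E -> measurable_fun setT g ->
   (\int[mu]_t g (a * t + b)%R)%E = (a^-1%:E * \int[mu]_t g t)%E.
  by move=> g0 mg; rewrite ge0_integral_affine.
rewrite /Rintegral integralE [in RHS]integralE.
have /= Hp := H _ (@funepos_ge0 _ _ (EFin \o f)) (measurable_funepos mf).
have /= Hn := H _ (@funeneg_ge0 _ _ (EFin \o f)) (measurable_funeneg mf).
have pfin := integrable_pos_fin_num measurableT intf.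
have nfin := integrable_neg_fin_num measurableT intf.
rewrite (_ : integral _ _ _ = \int[mu]_t (EFin \o f)^\+ (a * t + b)%R)%E;
  last by apply: eq_integral => t _; rewrite !funeposE.
rewrite (_ : (_ - _)%E = (a^-1%:E * \int[mu]_t (EFin \o f)^\+ t -
    a^-1%:E * \int[mu]_t (EFin \o f)^\- t)%E); last first.
  by rewrite -Hp -Hn; congr (_ - _)%E; apply: eq_integral => t _; rewrite !funenegE.
rewrite [in RHS]fineB// fineB ?fin_numM// !fineM//= -mulrBr mulrA.
by rewrite mulfV ?mul1r// gt_eqF.
Qed.

End affine_line.

Lemma integrable_bounded_support d (T : measurableType d) (R : realType)
    (mu : {measure set T -> \bar R}) (D : set T) (M : R) (f : T -> R) :
  measurable D -> (mu D < +oo)%E -> measurable_fun setT f ->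
  (forall x, `|f x| <= M) -> (forall x, f x != 0 -> D x) ->
  mu.-integrable setT (EFin \o f).
Proof.
move=> mD Dfin mf fM fD.
have -> : EFin \o f = (EFin \o f) \_ D.
  apply/funext => x; rewrite /patch/=; case: ifPn => // /negP xD; congr EFin.
  by apply/eqP/negPn/negP => /fD ?; apply: xD; rewrite inE.
apply/(integrable_mkcond _ mD).1.
apply: measurable_bounded_integrable => //; first exact: measurable_funTS.
exists M; split; first by rewrite num_real.
by move=> x Mx t _ /=; rewrite (le_trans (fM t))// ltW.
Qed.

Lemma Rintegral_indicZ d (T : measurableType d) (R : realType)
    (mu : {measure set T -> \bar R}) (D : set T) (r : R) :
  measurable D -> (mu D < +oo)%E ->
  \int[mu]_x (r * \1_D x) = r * fine (mu D).
Proof.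
move=> mD Dfin; rewrite RintegralZl//; last first.
  apply: (@integrable_bounded_support _ _ _ _ D 1) => //.
  - by move=> x; rewrite indicE; case: (_ \in _); rewrite ?normr1 ?normr0.
  - by move=> x; rewrite indicE pnatr_eq0 eqb0 negbK inE.
by rewrite /Rintegral integral_indic// setIT.
Qed.

(** * Atoms on a line and their pairings *)

Section line_atoms.
Context {R : realType}.
Notation mu := (@lebesgue_measure R).
Implicit Types (F G v : R -> R).

Lemma lebesgue_itv_fin (a b : bool) (x y : R) :
  (mu [set` Interval (BSide a x) (BSide b y)] < +oo)%E.
Proof. by rewrite lebesgue_measure_itv/=; case: ifP => _; rewrite ltry. Qed.

Lemma integrable_line (c r M : R) F : measurable_fun setT F ->
  (forall t, `|F t| <= M) -> (forall t, F t != 0 -> `|t - c| <= r) ->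
  mu.-integrable setT (EFin \o F).
Proof.
move=> mF FM Fr; apply: (@integrable_bounded_support _ _ _ mu `[c - r, c + r]%classic M) => //.
- exact: lebesgue_itv_fin.
- by move=> t /Fr; rewrite ler_distl /= in_itv/=.
Qed.

(** Translating each term turns the integrand into [v] times a difference of indicators of two
    shifted windows. At the left end this difference is nonpositive, at the right end it is positive
    on a set of length at most [2 * delta]. Hence the bound depends on the displacement and not on
    the size of the window. *)
Lemma Rintegral_displacement (V c r delta : R) v :
  nondecreasing_fun v -> (forall t, 0 <= v t <= V) -> 0 <= delta ->
  0 <= r ->
  \int[mu]_t (\1_`[c - r, c + r]%classic t * (v (t + delta) - v (t - delta))) <=
  2 * delta * V.
Proof.
move=> vnd vV d0 r0; set W := `[_, _]%classic.
have mW : measurable (W : set (measurableTypeR R)) by exact: measurable_itv.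
have mv := nondecreasing_measurable measurableT vnd.
have int1 s : mu.-integrable setT (EFin \o (fun t => \1_W (t - s) * v t)).
  apply: (@integrable_line (c + s) r V).
  - apply: measurable_funM => //; apply: measurableT_comp.
      exact/measurable_indic.
    exact: measurable_funB.
  - move=> t; have /andP[v0 v1] := vV t; rewrite normrM indicE.
    by case: (_ \in _); rewrite ?normr1 ?mul1r ?normr0 ?mul0r ?ger0_norm ?(le_trans v0).
  - move=> t; rewrite indicE mulf_eq0 negb_or pnatr_eq0 eqb0 negbK => /andP[]; rewrite inE.
    by rewrite /W/= in_itv/= ler_distl => /andP[? ?] _; apply/andP; split; lra.
have shift s : \int[mu]_t (\1_W t * v (t + s)) = \int[mu]_t (\1_W (t - s) * v t).
  rewrite -[RHS](Rintegral_affine s ltr01 (int1 s)) mul1r.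
  by apply: eq_Rintegral => t _; rewrite mul1r addrK.
have int2 s : mu.-integrable setT (EFin \o (fun t => \1_W t * v (t + s))).
  apply: (@integrable_line c r V).
  - apply: measurable_funM; first exact/measurable_indic.
    by apply: measurableT_comp => //; exact: measurable_funD.
  - move=> t; have /andP[v0 v1] := vV (t + s); rewrite normrM indicE.
    by case: (_ \in _); rewrite ?normr1 ?mul1r ?normr0 ?mul0r ?ger0_norm ?(le_trans v0).
  - move=> t; rewrite indicE mulf_eq0 negb_or pnatr_eq0 eqb0 negbK => /andP[]; rewrite inE.
    by rewrite /W/= in_itv/= ler_distl => /andP[? ?] _; apply/andP; split; lra.
under eq_Rintegral do rewrite mulrBr.
rewrite RintegralB// !shift -RintegralB//.
(* [I] contains every [t] with [t - delta] in [W] and [t + delta] outside [W], the only points where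
   the translated integrand can be positive. *)
pose I := `]c + r - delta, c + r + delta]%classic : set (measurableTypeR R).
have mI : measurable I by exact: measurable_itv.
have -> : 2 * delta * V = V * fine (mu I).
  rewrite lebesgue_measure_itv/= lte_fin.
  case: ltP => h /=; first by ring.
  by rewrite (_ : delta = 0) ?mulr0 ?mul0r//; lra.
rewrite -Rintegral_indicZ//; last exact: lebesgue_itv_fin.
apply: le_Rintegral => //.
- exact: (@integrableB _ _ _ mu setT measurableT _ _ (int1 delta) (int1 (- delta))).
- apply: (@integrable_line (c + r) delta `|V|).
  + by apply: measurable_funM => //; exact/measurable_indic.
  + by move=> t; rewrite normrM indicE; case: (_ \in _); rewrite ?normr1 ?mulr1 ?normr0 ?mulr0.
  + move=> t; rewrite indicE mulf_eq0 negb_or pnatr_eq0 eqb0 negbK => /andP[_]; rewrite inE.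
    by rewrite /I/= in_itv/= ler_distl => /andP[? ?]; apply/andP; split; lra.
- move=> t _; have /andP[v0 v1] := vV t; have V0 := le_trans v0 v1.
  rewrite -mulrBl !indicE; have [tI|tI] := boolP (t \in I).
    rewrite mulr1; apply: (@le_trans _ _ (1 * v t)); last by rewrite mul1r.
    rewrite ler_wpM2r//.
    by case: (t - delta \in W); case: (_ \in W); rewrite /= ?mulr1n ?mulr0n; lra.
  rewrite mulr0; have [tW|tW] := boolP (t - delta \in W); last first.
    by rewrite sub0r mulNr oppr_le0 mulr_ge0.
  rewrite (_ : t - - delta \in W); first by rewrite subrr mul0r.
  move: tW; rewrite !inE /W/= !in_itv/= opprK => /andP[? ?].
  apply/andP; split; first lra.
  move/negP: tI; rewrite inE /I/= in_itv/= => /negP; rewrite negb_and.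
  by move=> /orP[]; rewrite -?leNgt -?ltNge => ?; lra.
Qed.

(** [c] and [r] locate the support, [V] bounds the variation and [kappa] the L1 norm. The variation
    function [v] is a parameter because its increments over small windows enter the pairing bound
    [atom_inner]. *)
Definition atom (c r V kappa : R) v G :=
  [/\ dominates V v G, forall t, G t != 0 -> `|t - c| <= r,
      \int[mu]_t G t = 0 & \int[mu]_t `|G t| <= kappa].

Lemma atom_le c r V kappa V' kappa' v G : V <= V' -> kappa <= kappa' ->
  atom c r V kappa v G -> atom c r V' kappa' v G.
Proof.
move=> VV kk [[vG v0 vV] Gr G0 Gk]; split => //; last exact: le_trans kk.
by split => // x; exact: le_trans VV.
Qed.

Lemma atom0 c r V kappa : 0 <= V -> 0 <= kappa -> atom c r V kappa (fun=> 0) (fun=> 0).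
Proof.
move=> V0 k0; split.
- by split => // x y _; rewrite !subrr normr0.
- by move=> t; rewrite eqxx.
- by rewrite Rintegral_cst// mul0r.
- by under eq_Rintegral do rewrite normr0; rewrite Rintegral_cst// mul0r.
Qed.

Lemma dominates_support_normr c r V v F : dominates V v F ->
  (forall t, F t != 0 -> `|t - c| <= r) -> forall t, `|F t| <= V.
Proof.
move=> vF Fr; apply: (dominates_normr vF (z := c + `|r| + 1)).
apply/eqP/negPn/negP => /Fr; rewrite (_ : _ - c = `|r| + 1); last by ring.
have := ler_norm r; have := normr_ge0 r => ? ?; rewrite ger0_norm; lra.
Qed.

Lemma dominates_integrable c r V v F : dominates V v F ->
  (forall t, F t != 0 -> `|t - c| <= r) -> mu.-integrable setT (EFin \o F).
Proof.
move=> vF Fr; apply: (integrable_line (dominates_measurable vF) _ Fr).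
exact: dominates_support_normr vF Fr.
Qed.

(** Mean zero is the change of variables with Jacobian [a]. For the L1 norm, write the difference as
    [(F t - F (a * t + b)) + (1 - a) * F (a * t + b)]. On the support the first part is at most
    [v (t + delta) - v (t - delta)], to which [Rintegral_displacement] applies; the second is at
    most [eps], on an interval of length [2 * r]. *)
Lemma atom_affine (a b c r delta eps : R) v F : 0 < a -> 0 <= r -> 0 <= delta ->
  dominates 1 v F ->
  (forall t, F t != 0 -> `|t - c| <= r) ->
  (forall t, F (a * t + b) != 0 -> `|t - c| <= r) ->
  `|a - 1| <= eps ->
  (forall t, `|t - c| <= r -> `|a * t + b - t| <= delta) ->
  atom c r (1 + a) (2 * delta + eps * (2 * r)) (fun t => v t + a * v (a * t + b))
    (fun t => F t - a * F (a * t + b)).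
Proof.
move=> a0 r0 d0 vF Fr Far a1 dr.
have phi_nd : nondecreasing_fun (fun t => a * t + b).
  by move=> x y xy; rewrite lerD2r ler_pM2l.
have vFa := dominates_comp phi_nd vF.
have vFa' : dominates a (fun t => a * v (a * t + b)) (fun t => a * F (a * t + b)).
  by have := dominatesZ a vFa; rewrite gtr0_norm// mulr1.
have vG := dominatesB vF vFa'.
have F1 := dominates_support_normr vF Fr.
have vnd := dominates_nondecreasing vF.
have [vFd v0 v1] := vF.
have intF := dominates_integrable vF Fr.
have Far' t : a * F (a * t + b) != 0 -> `|t - c| <= r.
  by rewrite mulf_eq0 negb_or => /andP[_ /Far].
have intFa := dominates_integrable vFa' Far'.
have Gr t : F t - a * F (a * t + b) != 0 -> `|t - c| <= r.
  have [->|/Fr//] := eqVneq (F t) 0.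
  by rewrite sub0r oppr_eq0 => /Far'.
have intG := dominates_integrable vG Gr.
split => //.
- rewrite RintegralB// RintegralZl//; last exact: dominates_integrable vFa Far.
  by rewrite Rintegral_affine ?subrr.
- pose W := `[c - r, c + r]%classic : set (measurableTypeR R).
  have mW : measurable W by exact: measurable_itv.
  have WE t : (t \in W) = (`|t - c| <= r).
    by apply/idP/idP; rewrite inE /W/= in_itv/= ler_distl.
  have vb t : `|v t| <= 1 by rewrite ger0_norm.
  have mv := nondecreasing_measurable measurableT vnd.
  have int1 : mu.-integrable setT
      (EFin \o (fun t => \1_W t * (v (t + delta) - v (t - delta)))).
    apply: (@integrable_line c r 2).
    + apply: measurable_funM; first exact/measurable_indic.
      apply: measurable_funB.
        by apply: measurableT_comp => //; exact: measurable_funD.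
      by apply: measurableT_comp => //; exact: measurable_funB.
    + move=> t; rewrite normrM indicE.
      case: (_ \in _); rewrite ?normr1 ?normr0 ?mul1r ?mul0r//.
      by rewrite (le_trans (ler_normB _ _))// lerD.
    + by move=> t; rewrite indicE mulf_eq0 negb_or pnatr_eq0 eqb0 negbK WE => /andP[].
  have int2 : mu.-integrable setT (EFin \o (fun t => eps * \1_W t)).
    apply: (@integrable_line c r `|eps|).
    + by apply: measurable_funM => //; exact/measurable_indic.
    + move=> t; rewrite normrM indicE.
      by case: (_ \in _); rewrite ?normr1 ?normr0 ?mulr1 ?mulr0.
    + by move=> t; rewrite indicE mulf_eq0 negb_or pnatr_eq0 eqb0 negbK WE => /andP[].
  apply: (@le_trans _ _ (\int[mu]_t (\1_W t * (v (t + delta) - v (t - delta)) +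
      eps * \1_W t))).
    apply: le_Rintegral => //.
    + exact: (integrable_abse intG).
    + exact: (@integrableD _ _ _ mu setT measurableT _ _ int1 int2).
    + move=> t _; rewrite indicE WE; have [tr|tr] := boolP (`|t - c| <= r); last first.
        rewrite mulr0n mulr0 mul0r addr0 normr_le0.
        by apply: contraNT tr => /Gr.
      rewrite mulr1n mulr1 mul1r (_ : _ - _ = (F t - F (a * t + b)) +
        (1 - a) * F (a * t + b)); last by ring.
      rewrite (le_trans (ler_normD _ _))// lerD//; last first.
        rewrite normrM -[leRHS]mulr1 ler_pM// distrC//.
      have := dr _ tr; rewrite ler_distl => /andP[dr1 dr2].
      have [tphi|/ltW tphi] := leP t (a * t + b).
        rewrite distrC (le_trans (vFd _ _ tphi))// lerB//; apply: vnd; lra.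
      rewrite (le_trans (vFd _ _ tphi))// lerB//; apply: vnd; lra.
  rewrite RintegralD// lerD//.
    rewrite -[X in _ <= X]mulr1; apply: Rintegral_displacement => // t.
    by rewrite v0 v1.
  rewrite Rintegral_indicZ//; last exact: lebesgue_itv_fin.
  have e0 : 0 <= eps by rewrite (le_trans _ a1).
  have : mu W = _ := lebesgue_measure_itv `[c - r, c + r].
  rewrite /= lte_fin => ->; rewrite ler_wpM2l//; case: ifP => _ /=; lra.
Qed.

(** Since [G'] has mean zero, the constant [G c'] may be subtracted from [G]; on the support of [G']
    the remainder is at most the increment of [v] there. Unlike an oscillation, this increment is
    additive over adjacent windows, so it can be summed over a grid. *)
Lemma atom_inner c r V kappa v G c' r' V' kappa' v' G' :
  atom c r V kappa v G -> atom c' r' V' kappa' v' G' -> 0 <= r' ->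
  `|\int[mu]_t (G t * G' t)| <= kappa' * (v (c' + r') - v (c' - r')).
Proof.
move=> [vG Gr _ _] [vG' Gr' G'0 G'k] r'0.
have intG' := dominates_integrable vG' Gr'.
have mG := dominates_measurable vG.
have mG' := dominates_measurable vG'.
have GV := dominates_support_normr vG Gr.
have G'V := dominates_support_normr vG' Gr'.
have intGG' : mu.-integrable setT (EFin \o (fun t => G t * G' t)).
  apply: (@integrable_line c' r' (V * V')); first exact: measurable_funM.
    by move=> t; rewrite normrM ler_pM.
  by move=> t; rewrite mulf_eq0 negb_or => /andP[_ /Gr'].
have intZ k : mu.-integrable setT (EFin \o (fun t => k * G' t)).
  exact: (integrableZl measurableT k intG').
have -> : \int[mu]_t (G t * G' t) = \int[mu]_t ((G t - G c') * G' t).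
  under [RHS]eq_Rintegral do rewrite mulrBl.
  rewrite RintegralB//.
  by rewrite RintegralZl// G'0 mulr0 subr0.
have intD : mu.-integrable setT (EFin \o (fun t => (G t - G c') * G' t)).
  rewrite (_ : _ \o _ = EFin \o ((fun t => G t * G' t) \- (fun t => G c' * G' t))).
    by apply: (integrableB measurableT intGG' (intZ _)).
  by apply/funext => t /=; rewrite mulrBl.
rewrite (le_trans (le_normr_Rintegral _ intD))//.
have vnd := dominates_nondecreasing vG.
set w := v _ - v _.
have w0 : 0 <= w by rewrite subr_ge0; apply: vnd; lra.
apply: (@le_trans _ _ (\int[mu]_t (w * `|G' t|))).
  apply: le_Rintegral => //.
  - exact: (integrable_abse intD).
  - exact: (integrableZl measurableT w (integrable_abse intG')).
  - move=> t _; rewrite normrM.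
    have [->|/Gr'] := eqVneq (G' t) 0; first by rewrite normr0 !mulr0.
    rewrite ler_distl => /andP[t1 t2]; rewrite ler_wpM2r//.
    have [vGd _ _] := vG.
    have [ct|/ltW tc] := leP c' t.
      by rewrite (le_trans (vGd _ _ ct))// lerB//; apply: vnd; lra.
    by rewrite distrC (le_trans (vGd _ _ tc))// lerB//; apply: vnd; lra.
rewrite RintegralZl//; last exact: (integrable_abse intG').
by rewrite mulrC ler_wpM2r.
Qed.

Lemma atom_inner_far c r V kappa v G c' r' V' kappa' v' G' :
  atom c r V kappa v G -> atom c' r' V' kappa' v' G' ->
  r + r' < `|c - c'| -> \int[mu]_t (G t * G' t) = 0.
Proof.
move=> [_ Gr _ _] [_ Gr' _ _] cc'.
rewrite /Rintegral integral0_eq// => t _; congr EFin; apply/eqP.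
rewrite mulf_eq0; apply/negPn/negP; rewrite negb_or => /andP[/Gr tc /Gr' tc'].
have := ler_distD t c c'; rewrite (distrC c t); lra.
Qed.

End line_atoms.

(** * Dyadic scales and the decay between them *)

Section scales.
Context {R : realType}.

(** This is [2 ^ (p - N)] with natural exponents: [p] ranging over ['I_(2 * N).+1] yields the scales
    from [2 ^ (- N)] to [2 ^ N]. *)
Definition scale (N p : nat) : R := 2 ^+ p / 2 ^+ N.

Lemma scale_gt0 N p : 0 < scale N p.
Proof. by rewrite divr_gt0// exprn_gt0. Qed.

Lemma scale_le N p p' : (scale N p <= scale N p') = (p <= p')%N.
Proof. by rewrite ler_pM2r ?invr_gt0 ?exprn_gt0// ler_eXn2l// ltr1n. Qed.

(** Compared with the geometric mean of two scales, the smaller one loses a factor [Num.sqrt 2] per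
    step between them; this decay is what makes the sum over scales converge. *)
Lemma min_scale N p p' : Num.min (scale N p) (scale N p') =
  (Num.sqrt 2)^-1 ^+ `|p' - p|%N *
  (Num.sqrt (scale N p) * Num.sqrt (scale N p')).
Proof.
wlog pp : p p' / (p <= p')%N.
  move=> H; have [/H//|/ltnW/H] := leqP p p'.
  by rewrite minC distnC => ->; rewrite [X in _ * X]mulrC.
rewrite min_l ?scale_le// distnEl//.
have s0 : 0 < Num.sqrt 2 :> R by rewrite sqrtr_gt0.
have E : scale N p' = scale N p * (Num.sqrt 2 ^+ (p' - p)) ^+ 2.
  by rewrite exprAC sqr_sqrtr// /scale mulrAC -exprD subnKC.
rewrite E (sqrtrM _ (ltW (scale_gt0 _ _))) sqrtr_sqr.
rewrite ger0_norm ?exprn_ge0 ?(ltW s0)//.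
rewrite mulrA -expr2 sqr_sqrtr ?(ltW (scale_gt0 _ _))//.
rewrite mulrCA exprVn mulVf ?mulr1// expf_neq0// gt_eqF//.
Qed.

Definition geom : R := 2 * (1 - (Num.sqrt 2)^-1)^-1.

Lemma geom_ge0 : 0 <= geom.
Proof.
rewrite mulr_ge0// invr_ge0 subr_ge0 invf_le1 ?sqrtr_gt0//.
by rewrite -[leLHS]sqrtr1 ler_wsqrtr// ler1n.
Qed.

(** The weight balances the two directions: unweighted, each larger scale would contribute the full
    [scale N p0]. With it every term is [Num.sqrt (scale N p0)] times a power of [(Num.sqrt 2)^-1]
    whose exponent is the distance from [p] to [p0]. *)
Lemma sum_min_scale N M p0 :
  \sum_(p < M) (Num.sqrt (scale N p))^-1 * Num.min (scale N p0) (scale N p) <=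
  geom * Num.sqrt (scale N p0).
Proof.
have sgt p : 0 < Num.sqrt (scale N p) by rewrite sqrtr_gt0 scale_gt0.
rewrite (eq_bigr (fun p : 'I_M => (Num.sqrt 2)^-1 ^+ `|p - p0|%N *
  Num.sqrt (scale N p0))); last first.
  move=> p _; rewrite min_scale mulrCA; congr (_ * _).
  by rewrite mulrCA mulVf ?mulr1// gt_eqF.
rewrite -mulr_suml ler_wpM2r ?(ltW (sgt _))// sum_two_sided_geometric_le//.
rewrite invr_ge0 sqrtr_ge0 invf_lt1 ?sqrtr_gt0//=.
by rewrite -[ltLHS]sqrtr1 ltr_sqrt// ltr1n.
Qed.

(** The centre [(j - N + 1/2) * scale N p] of a dyadic interval, written as an arithmetic
    progression in [j] to match [count_grid]. *)
Definition gcenter (N p : nat) (j : nat) : R :=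
  (2^-1 - N%:R) * scale N p + j%:R * scale N p.

End scales.

(** * Row sums of the Gram matrix on one line *)

Section fibre_row_sum.
Context {R : realType}.
Notation mu := (@lebesgue_measure R).
Variables (d N M L : nat) (k : 'I_d) (V kappa : R) (x : 'I_d -> R).
Let I := ('I_M * {ffun 'I_d -> 'I_M})%type.
Variables (G v : I -> R -> R).
Hypotheses (V1 : 1 <= V) (k0 : 0 <= kappa).
Hypothesis atomG : forall i : I,
  atom (gcenter N i.1 (i.2 k)) (L%:R * scale N i.1) V (kappa * scale N i.1) (v i) (G i).
Hypothesis suppG : forall (i : I) t, G i t != 0 -> forall m, m != k ->
  `|x m - gcenter N i.1 (i.2 m)| <= L%:R * scale N i.1.

(** Nondecreasing functions whose increments over the window of a cube of scale [p] bound its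
    interaction with [i0] on the line of direction [k] with other coordinates [x m]. In direction
    [k], a cube that is not larger is weighed by the variation of [G i0], a larger one is merely
    detected near the centre of [i0]. In the other directions the step detects that the line passes
    near the cube. The dependence is on the scale only, as [count_grid] requires. *)
Let w (i0 : I) (p : nat) (m : 'I_d) : R -> R :=
  if m == k then
    if (p <= i0.1)%N then v i0
    else fun t => V * (gcenter N i0.1 (i0.2 k) <= t)%R%:R
  else fun t => V * (x m <= t)%R%:R.

Let wnd i0 p m : nondecreasing_fun (w i0 p m).
Proof.
have V0 : 0 <= V by exact: le_trans V1.
rewrite /w; case: ifP => _; [case: ifP => _|].
- by have [/dominates_nondecreasing] := atomG i0.
- exact: dominates_nondecreasing (dominates_step _ V0).
- exact: dominates_nondecreasing (dominates_step _ V0).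
Qed.

(** The atom of larger scale supplies its variation and the other one its L1 norm, whence the
    minimum of the scales. The factors with [m != k] equal [V >= 1] as soon as [G i] is nonzero
    somewhere on the line, so they can be inserted to reach the product form summed by
    [count_grid]. *)
Lemma atom_pair_bound (i0 i : I) :
  `|\int[mu]_t (G i0 t * G i t)| <=
  kappa * Num.min (scale N i0.1) (scale N i.1) *
  \prod_m (w i0 i.1 m (gcenter N i.1 (i.2 m) + (2 * L).+1%:R * scale N i.1) -
           w i0 i.1 m (gcenter N i.1 (i.2 m) - (2 * L).+1%:R * scale N i.1)).
Proof.
set D := \prod_m _; set s := scale N i.1; set s0 := scale N i0.1.
have V0 : 0 <= V by exact: le_trans V1.
have s_gt0 : 0 < s by exact: scale_gt0.
have s0_gt0 : 0 < s0 by exact: scale_gt0.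
(* The [+ 1] gives the strict inequalities: [L * s < rho], and [L * s0 + L * s < rho] if [s0 <= s],
   so that atoms with centres at least [rho] apart have disjoint supports. *)
pose rho := (2 * L).+1%:R * s.
have Lrho : L%:R * s < rho by rewrite ltr_pM2r// ltr_nat; lia.
have [GG0|GG0] := eqVneq (\int[mu]_t (G i0 t * G i t)) 0.
  rewrite GG0 normr0 mulr_ge0//.
    by rewrite mulr_ge0// le_min !ltW.
  apply: prodr_ge0 => m _; rewrite subr_ge0 (wnd i0 i.1 m)//.
  by rewrite lerD2l ge0_cp// mulr_ge0// ltW.
have step_k m y : `|y - gcenter N i.1 (i.2 m)| < rho ->
    V * (y <= gcenter N i.1 (i.2 m) + rho)%R%:R -
    V * (y <= gcenter N i.1 (i.2 m) - rho)%R%:R = V.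
  rewrite ltr_distl => /andP[y1 y2]; rewrite (ltW y2) leNgt y1/=.
  by rewrite mulr1 mulr0 subr0.
rewrite /D (bigD1 k)//= -[X in _ <= _ * (_ * X)]/(\prod_(m | m != k) _).
have D1 : 1 <= \prod_(m | m != k) (w i0 i.1 m (gcenter N i.1 (i.2 m) + rho) -
    w i0 i.1 m (gcenter N i.1 (i.2 m) - rho)).
  have [t Gt] : exists t, G i t != 0.
    apply: contrapT => G0; move/eqP: GG0; apply.
    rewrite /Rintegral integral0_eq// => t _; congr EFin.
    rewrite (_ : G i t = 0) ?mulr0//.
    by apply/eqP/negPn/negP => Gt; apply: G0; exists t.
  elim/big_rec: _ => // m z mk z1; rewrite -[1]mulr1 ler_pM//.
  rewrite /w (negbTE mk) step_k//.
  by rewrite (le_lt_trans (suppG Gt mk)).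
apply: le_trans (ler_wpM2l _ (ler_wpM2l _ D1)); rewrite ?mulr1; last 2 first.
- by rewrite mulr_ge0// le_min !ltW.
- by rewrite subr_ge0 wnd// lerD2l ge0_cp// mulr_ge0// ltW.
have [ii0|ii0] := leqP i.1 i0.1.
  rewrite min_r ?scale_le// /w eqxx ii0.
  apply: (le_trans (atom_inner (atomG i0) (atomG i) _)).
    by rewrite mulr_ge0// ltW.
  rewrite ler_wpM2l ?mulr_ge0 ?(ltW s_gt0)//.
  have [/dominates_nondecreasing vnd _ _ _] := atomG i0.
  by rewrite lerB// vnd// lerD2l ?lerN2 ltW.
(* For a larger cube [i] the cancellation is taken from [G i0]. The increment of [v i] is bounded
   crudely by [V], which is exactly the value of the step factor in direction [k], since the
   supports are not far apart. *)
have ss : s0 <= s by rewrite /s0 /s scale_le ltnW.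
rewrite (min_l ss) /w eqxx leqNgt ii0/=.
rewrite step_k; last first.
  rewrite ltNge; apply/negP => far; move/eqP: GG0; apply.
  apply: (atom_inner_far (atomG i0) (atomG i)).
  apply: lt_le_trans far; rewrite /rho -natr1 natrM mulrDl mul1r -mulrA.
  have : L%:R * s0 <= L%:R * s by rewrite ler_wpM2l.
  by rewrite -/s -/s0; lra.
under eq_Rintegral do rewrite mulrC.
apply: (le_trans (atom_inner (atomG i) (atomG i0) _)).
  by rewrite mulr_ge0// ltW.
rewrite ler_wpM2l ?mulr_ge0 ?(ltW s0_gt0)//.
have [[_ v0 vV] _ _ _] := atomG i.
by rewrite lerBlDr (le_trans (vV _))// lerDl.
Qed.

(** [count_grid] bounds the sum over the positions of one scale uniformly, then [sum_min_scale] adds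
    the scales. The constant depends neither on the line nor on [N] and [M], which later permits
    integration over lines and exhaustion by grids. *)
Lemma fibre_row_sum (i0 : I) :
  \sum_(i : I) (Num.sqrt (scale N i.1))^-1 * `|\int[mu]_t (G i0 t * G i t)| <=
  kappa * ((2 * (2 * L).+1)%:R * V) ^+ d * geom * Num.sqrt (scale N i0.1).
Proof.
have V0 : 0 <= V by exact: le_trans V1.
apply: (@le_trans _ _ (\sum_(p < M) (Num.sqrt (scale N p))^-1 *
   (kappa * Num.min (scale N i0.1) (scale N p) *
    ((2 * (2 * L).+1)%:R * V) ^+ d))).
  rewrite [leLHS](_ : _ = \sum_(p < M) \sum_(q : {ffun 'I_d -> 'I_M})
      (Num.sqrt (scale N p))^-1 * `|\int[mu]_t (G i0 t * G (p, q) t)|); last first.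
    by rewrite pair_bigA; apply: eq_bigr => -[].
  apply: ler_sum => p _; rewrite -mulr_sumr ler_wpM2l ?invr_ge0 ?sqrtr_ge0//.
  apply: (le_trans (ler_sum _ (fun q _ => atom_pair_bound i0 (p, q)))) => /=.
  rewrite -mulr_sumr ler_wpM2l//.
    by rewrite mulr_ge0// le_min !(ltW (scale_gt0 _ _)).
  apply: (@count_grid R d M _ (w i0 p)) => [m|m t|]; last exact/ltW/scale_gt0.
  - exact: wnd.
  - rewrite /w; case: ifP => _; [case: ifP => _|].
    + by have [[_ -> ->]] := atomG i0.
    + by have [_ -> ->] := dominates_step (gcenter N i0.1 (i0.2 k)) V0.
    + by have [_ -> ->] := dominates_step (x m) V0.
rewrite (eq_bigr (fun p : 'I_M => kappa * ((2 * (2 * L).+1)%:R * V) ^+ d *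
  ((Num.sqrt (scale N p))^-1 * Num.min (scale N i0.1) (scale N p)))); last first.
  by move=> p _; ring.
rewrite -mulr_sumr -[leRHS]mulrA ler_wpM2l ?sum_min_scale//.
by rewrite mulr_ge0// exprn_ge0// mulr_ge0.
Qed.

End fibre_row_sum.

(** * Lebesgue measure on column vectors *)

Section boxes.
Context {R : realType}.
Notation mu := (@lebesgue_measure R).

Definition box n (B : 'I_n -> set (measurableTypeR R)) : set 'cV[R]_n :=
  [set x | forall i, B i (x i ord0)].

Lemma measurable_box n (B : 'I_n -> set (measurableTypeR R)) :
  (forall i, measurable (B i)) -> measurable (box B).
Proof.
move=> mB; rewrite (_ : box B = \bigcap_(i in [set: 'I_n]) ((fun x => x i ord0) @^-1` B i)).
  apply: fin_bigcap_measurable => // i _; rewrite -[X in measurable X]setTI.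
  exact: (@measurable_coord R n i measurableT _ (mB i)).
by apply/seteqP; split => x /= Bx i; [move=> _|]; exact: Bx.
Qed.

Lemma colvec_cons0 n (t : R) (x : 'cV[R]_n) : colvec_cons (t, x) ord0 ord0 = t.
Proof.
transitivity (colvec_cons (t, x) (@lshift 1 n ord0) ord0).
  by congr (_ _ _); exact/val_inj.
by rewrite /colvec_cons (@col_mxEu _ 1) mxE eqxx.
Qed.

Lemma colvec_consS n (t : R) (x : 'cV[R]_n) i :
  colvec_cons (t, x) (lift ord0 i) ord0 = x i ord0.
Proof.
rewrite /colvec_cons (_ : lift ord0 i = @rshift 1 n i); last exact/val_inj.
by rewrite (@col_mxEd _ 1).
Qed.

Lemma borel_lebesgue_box n (B : 'I_n -> set (measurableTypeR R)) :
  (forall i, measurable (B i)) ->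
  borel_lebesgue R n (box B) = (\prod_(i < n) mu (B i))%E.
Proof.
elim: n B => [|n IH] B mB.
  rewrite big_ord0 /= (_ : box B = setT); last by apply/seteqP; split => // x _ [].
  by rewrite diracT.
rewrite big_ord_recl -IH//= /borel_lebesgue_step /pushforward.
rewrite (_ : _ @^-1` _ = B ord0 `*` box (fun i => B (lift ord0 i))).
  by rewrite product_measure1E//; exact: measurable_box.
apply/seteqP; split => [[t x]/= Bx|[t x]/= [Bt Bx] i].
  split; first by have := Bx ord0; rewrite colvec_cons0.
  by move=> i; have := Bx (lift ord0 i); rewrite colvec_consS.
by case: (unliftP ord0 i) => [j ->|->]; rewrite ?colvec_consS ?colvec_cons0.
Qed.

Definition boxes n : set (set 'cV[R]_n) :=
  [set box B | B in [set B | forall i, measurable (B i)]].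

Lemma boxes_setI n : setI_closed (@boxes n).
Proof.
move=> _ _ [B mB <-] [C mC <-]; exists (fun i => B i `&` C i).
  by move=> i; exact: measurableI.
by apply/seteqP; split => x /= => [h|[]]; [split=> i; have [] := h i|].
Qed.

Lemma sigma_boxes n : measurable = <<s @boxes n >>.
Proof.
apply/seteqP; split.
  apply: smallest_sub; first exact: smallest_sigma_algebra.
  move=> A; rewrite -bigcup_seq/= => -[i _ [Y mY <-]]; apply: sub_sigma_algebra.
  exists (fun j => if j == i then Y else setT); first by move=> j /=; case: ifP.
  rewrite setTI; apply/seteqP; split => x /=.
    by move=> /(_ i); rewrite eqxx.
  by move=> Yx j; case: eqP => [->|].
apply: smallest_sub; first exact: sigma_algebra_measurable.
by move=> _ [B mB <-]; exact: measurable_box.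
Qed.

Lemma borel_lebesgue_unique n (m : {measure set 'cV[R]_n -> \bar R}) :
  (forall B : 'I_n -> set (measurableTypeR R), (forall i, measurable (B i)) ->
    m (box B) = (\prod_(i < n) mu (B i))%E) ->
  forall A, measurable A -> borel_lebesgue R n A = m A.
Proof.
move=> mE; apply: (measure_unique (@boxes n)
  (fun k => box (fun=> `[- k%:R, k%:R]%classic))).
- exact: sigma_boxes.
- exact: boxes_setI.
- by move=> k; exists (fun=> `[- k%:R, k%:R]%classic) => // i; exact: measurable_itv.
- apply/seteqP; split => // x _.
  exists (\max_i (Num.bound `|x i ord0|)) => // i /=.
  rewrite in_itv/= -ler_norml (le_trans (ltW (archi_boundP (normr_ge0 _))))//.
  by rewrite ler_nat; exact: (@leq_bigmax _ (fun i => Num.bound `|x i ord0|)).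
- by move=> _ [B mB <-]; rewrite mE//; exact: borel_lebesgue_box.
- move=> k; have /= -> := @borel_lebesgue_box n (fun=> `[- k%:R, k%:R]%classic)
    (fun=> measurable_itv _).
  rewrite -ge0_fin_numE; last by apply: prode_ge0.
  elim/big_ind: _ => // [a b|i _]; first exact: fin_numM.
  by rewrite lebesgue_measure_itv/=; case: ifP.
Qed.

(** The analogue of [colvec_cons] for an arbitrary coordinate: for fixed [y],
    [t |-> insert k (t, y)] parametrises a line in direction [k]. *)
Definition insert n (k : 'I_n.+1) (p : measurableTypeR R * 'cV[R]_n) : 'cV[R]_n.+1 :=
  \col_i (if unlift k i is Some j then p.2 j ord0 else p.1).

Lemma insert_at n k t (x : 'cV[R]_n) : insert k (t, x) k ord0 = t.
Proof. by rewrite mxE unlift_none. Qed.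

Lemma insert_lift n k t (x : 'cV[R]_n) j :
  insert k (t, x) (lift k j) ord0 = x j ord0.
Proof. by rewrite mxE liftK. Qed.

Lemma insertK n k (x : 'cV[R]_n.+1) :
  insert k (x k ord0, \col_j x (lift k j) ord0) = x.
Proof.
apply/colP => i; case: (unliftP k i) => [j ->|->].
  by rewrite insert_lift mxE.
by rewrite insert_at.
Qed.

Lemma measurable_insert n (k : 'I_n.+1) : measurable_fun setT (@insert n k).
Proof.
apply: measurable_fun_colvecP => i.
under eq_fun do rewrite mxE.
case: (unliftP k i) => [j _|_]; last exact: measurable_fst.
by apply: (measurableT_comp (measurable_coord j)); exact: measurable_snd.
Qed.

(** [borel_lebesgue] is built by splitting off coordinate 0; agreement on boxes and uniqueness allow
    any coordinate [k] to be split off instead. *)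
Lemma borel_lebesgue_insert n (k : 'I_n.+1) (A : set 'cV[R]_n.+1) :
  measurable A ->
  borel_lebesgue R n.+1 A = (mu \x borel_lebesgue R n)%E (insert k @^-1` A).
Proof.
move=> mA.
pose m : {measure set 'cV[R]_n.+1 -> \bar R} :=
  pushforward (mu \x borel_lebesgue R n)%E (@insert n k).
rewrite -[RHS]/(m (measurable_insert k) A).
apply: borel_lebesgue_unique => // B mB; rewrite /m /= /pushforward.
rewrite (_ : _ @^-1` _ = B k `*` box (fun i => B (lift k i))).
  rewrite product_measure1E//; last exact: measurable_box.
  rewrite borel_lebesgue_box// (bigD1_ord k)//=.
apply/seteqP; split => [[t x]/= Bx|[t x]/= [Bt Bx] i].
  split; first by have := Bx k; rewrite insert_at.
  by move=> i; have := Bx (lift k i); rewrite insert_lift.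
by case: (unliftP k i) => [j ->|->]; rewrite ?insert_lift ?insert_at.
Qed.

End boxes.

(** * Carathéodory-measurable objects modulo Borel null sets *)

Section completion.
Local Open Scope ereal_scope.
Context d (T : measurableType d) (R : realType).
Variable mu : {measure set T -> \bar R}.
Local Notation ext := (mu^*)%mu.

(** Intersect countably many measurable covers whose measures exceed the outer measure by at most
    [1 / n.+1]. *)
Lemma mu_ext_hull (X : set T) : ext X < +oo ->
  exists H, [/\ measurable H, X `<=` H & mu H = ext X].
Proof.
move=> Xoo.
have cover (n : nat) : exists F, [/\ measurable F, X `<=` F &
    mu F <= ext X + n.+1%:R^-1%:E].
  have fin : ext X \is a fin_num by rewrite ge0_fin_numE// mu_ext_ge0.
  have n0 : (0 < n.+1%:R^-1 :> R)%R by rewrite invr_gt0.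
  have [_ [A [mA XA] <-] /ltW le] := lb_ereal_inf_adherent n0 fin.
  exists (\bigcup_k A k); split => //; first exact: bigcupT_measurable.
  apply: le_trans le; apply: measure_sigma_subadditive => //.
  exact: bigcupT_measurable.
have /boolp.choice[F HF] := cover.
exists (\bigcap_n F n).
have mF : measurable (\bigcap_n F n).
  by apply: bigcapT_measurable => n; have [] := HF n.
have XF : X `<=` \bigcap_n F n by move=> x Xx n _; have [_ + _] := HF n; apply.
split => //; apply/eqP; rewrite eq_le; apply/andP; split; last first.
  by rewrite -(measurable_mu_extE mu mF) le_mu_ext.
apply/lee_addgt0Pr => _/posnumP[e]; near \oo => n.
have [mFn _ le] := HF n.
apply: (@le_trans _ _ (mu (F n))).
  by rewrite le_measure ?inE//; exact: bigcap_inf.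
rewrite (le_trans le)// leeD// lee_fin ltW//.
by near: n; apply: near_infty_natSinv_lt.
Unshelve. all: by end_near. Qed.

(** On each piece of finite measure take a measurable hull. By Carathéodory's condition its excess
    over [E] has outer measure zero, hence lies in a measurable null set; [N] is the union of these
    null sets. *)
Lemma caratheodory_measurable_borel (E : set (caratheodory_type ext)) :
  sigma_finite setT mu -> measurable E ->
  exists B N : set T, [/\ measurable B, measurable N, mu N = 0 &
    forall x, ~ N x -> E x <-> B x].
Proof.
move=> [S ST mS] mE.
have cmS k : measurable (S k : set (caratheodory_type ext)).
  by apply: caratheodory_measurable_mu_ext; have [] := mS k.
have piece k : exists HN : set T * set T, [/\ measurable HN.1, measurable HN.2,
    mu HN.2 = 0 & E `&` S k `<=` HN.1 /\ HN.1 `\` (E `&` S k) `<=` HN.2].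
  have [mSk Skoo] := mS k.
  have ESoo : ext (E `&` S k) < +oo.
    by rewrite (le_lt_trans _ Skoo)// -(measurable_mu_extE mu mSk) le_mu_ext.
  have [H [mH EH HE]] := mu_ext_hull ESoo.
  have cmH : measurable (H : set (caratheodory_type ext)).
    exact: caratheodory_measurable_mu_ext.
  have D0 : ext (H `\` (E `&` S k)) = 0.
    have cmES : measurable ((E `&` S k) : set (caratheodory_type ext)).
      exact: measurableI.
    have : ext H = ext (H `&` (E `&` S k)) + ext (H `&` ~` (E `&` S k)) := cmES H.
    rewrite setIidr// -setDE.
    rewrite (measurable_mu_extE mu mH) HE.
    have fin : ext (E `&` S k) \is a fin_num by rewrite ge0_fin_numE// mu_ext_ge0.
    move=> /eqP; rewrite addeC -sube_eq ?fin_num_adde_defl//.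
    by rewrite subee// => /eqP.
  have [N [mN HN N0]] := @mu_ext_hull (H `\` (E `&` S k)) ltac:(by rewrite D0).
  by exists (H, N); split => //; rewrite N0 D0.
have /boolp.choice[HN HHN] := piece.
exists (\bigcup_k (HN k).1), (\bigcup_k (HN k).2); split.
- by apply: bigcupT_measurable => k; have [] := HHN k.
- by apply: bigcupT_measurable => k; have [] := HHN k.
- apply/eqP; rewrite -measure_le0; apply: (le_trans (measure_sigma_subadditive _ _ _ (@subset_refl _ _))).
  + by move=> k; have [] := HHN k.
  + by apply: bigcupT_measurable => k; have [] := HHN k.
  + by rewrite eseries0// => k _ _; have [] := HHN k.
- move=> x Nx; split => [Ex|[k _ Hx]].
    have : [set: T] x by []. 
    by rewrite ST => -[k _ Sx]; exists k => //; have [_ _ _ [+ _]] := HHN k; apply.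
  apply: contrapT => nEx; apply: Nx; exists k => //.
  by have [_ _ _ [_]] := HHN k; apply; split => // -[].
Qed.

Lemma caratheodory_measurable_mod_null (E : set T) (B N : set T) :
  measurable B -> measurable N -> mu N = 0 -> (forall x, ~ N x -> E x <-> B x) ->
  measurable (E : set (caratheodory_type ext)).
Proof.
move=> mB mN N0 EB.
rewrite (_ : E = (B `\` N) `|` (E `&` N)); last first.
  apply/seteqP; split => x.
    by move=> Ex; have [Nx|Nx] := pselect (N x); [right|left; split => //; exact/EB].
  by move=> [[Bx /EB ->]|[]].
apply: measurableU.
  by apply: caratheodory_measurable_mu_ext; exact: measurableD.
apply: measure_is_complete_caratheodory; exists N; split => //.
- exact: caratheodory_measurable_mu_ext.
- by rewrite /= -N0 measurable_mu_extE.
Qed.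

(** The superlevel sets at rational levels determine [f]; off the countable union of their
    exceptional null sets each of them is Borel. *)
Lemma caratheodory_measurable_fun_borel (f : T -> R) :
  sigma_finite setT mu ->
  measurable_fun setT (f : caratheodory_type ext -> R) ->
  exists N : set T, [/\ measurable N, mu N = 0 & measurable_fun (~` N) f].
Proof.
move=> sf mf.
have level (q : rat) : exists BN : set T * set T, [/\ measurable BN.1,
    measurable BN.2, mu BN.2 = 0 &
    forall x, ~ BN.2 x -> (ratr q < f x)%R <-> BN.1 x].
  have mE : measurable ([set x | (ratr q < f x)%R] : set (caratheodory_type ext)).
    have := mf measurableT _ (measurable_itv `]ratr q, +oo[).
    rewrite setTI (_ : _ @^-1` _ = [set x | (ratr q < f x)%R])//.
    by apply/seteqP; split => x /=; rewrite in_itv/= andbT.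
  have [B [N [mB mN N0 H]]] := caratheodory_measurable_borel sf mE.
  by exists (B, N).
have /boolp.choice[BN HBN] := level.
have mN : measurable (\bigcup_q (BN q).2).
  by apply: bigcupT_measurable_rat => q; have [] := HBN q.
exists (\bigcup_q (BN q).2); split => //.
  have : mu.-negligible (\bigcup_q (BN q).2).
    have /ppcard_eqP[e] := card_rat.
    rewrite (_ : \bigcup_q _ = \bigcup_n (BN (e^-1%FUN n)).2).
      apply: negligible_bigcup => n; exists (BN (e^-1%FUN n)).2.
      by have [_ mNn Nn0 _] := HBN (e^-1%FUN n); split.
    apply/seteqP; split => x [q _ Nx]; last by exists (e^-1%FUN q).
    by exists (e q) => //; rewrite funK ?inE.
  by move/(measure_negligible mN).
move=> mD; apply: (measurability _ (RGenOInfty.measurableE R)) => //.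
move=> _ [_ [r ->] <-].
rewrite (_ : _ `&` _ = \bigcup_(q : rat)
    ((if (r < ratr q)%R then (BN q).1 else set0) `\` \bigcup_q (BN q).2)).
  apply: bigcupT_measurable_rat => q; apply: measurableD => //.
  by case: ifP => // _; have [] := HBN q.
apply/seteqP; split => x /=.
  rewrite in_itv/= andbT => -[Nx /rat_in_itvoo[q]]; rewrite in_itv/= => /andP[rq qf].
  exists q => //; rewrite rq; split => //.
  by have [_ _ _ H] := HBN q; apply/H => // Nqx; apply: Nx; exists q.
move=> [q _ []]; case: ifP => // rq Bx Nx; split => //.
rewrite in_itv/= andbT (lt_trans rq)//.
by have [_ _ _ H] := HBN q; apply/H => // Nqx; apply: Nx; exists q.
Qed.

(** A Borel map alone may pull a subset of a null set back to a nonmeasurable set; the condition on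
    null sets excludes this. *)
Lemma caratheodory_measurable_fun_comp (f : T -> R) (phi : T -> T) :
  sigma_finite setT mu -> measurable_fun setT phi ->
  (forall N, measurable N -> mu N = 0 -> mu (phi @^-1` N) = 0) ->
  measurable_fun setT (f : caratheodory_type ext -> R) ->
  measurable_fun setT (f \o phi : caratheodory_type ext -> R).
Proof.
move=> sf mphi phi0 mf _ Y mY; rewrite setTI.
have := mf measurableT _ mY; rewrite setTI => mE.
have [B [N [mB mN N0 EB]]] := caratheodory_measurable_borel sf mE.
have pm A : measurable A -> measurable (phi @^-1` A).
  by move=> mA; rewrite -[X in measurable X]setTI; exact: mphi.
apply: (@caratheodory_measurable_mod_null _ (phi @^-1` B) (phi @^-1` N)); [| |exact: phi0|].
- exact: pm.
- exact: pm.
- by move=> x Nx; exact: EB.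
Qed.

Lemma caratheodory_measurable_funT (f : T -> R) : measurable_fun setT f ->
  measurable_fun setT (f : caratheodory_type ext -> R).
Proof.
move=> mf _ Y mY; apply: caratheodory_measurable_mu_ext.
exact: mf.
Qed.

Local Notation cmu := (@completed_measure_extension _ _ _ mu).

(** The two integrals are compared by pushing forward along the identity, which is measurable from
    the completed to the original sigma-algebra. *)
Lemma integral_completed (f : T -> R) (N : set T) :
  measurable_fun setT (f : caratheodory_type ext -> R) ->
  measurable N -> mu N = 0 -> measurable_fun (~` N) f ->
  cmu.-integrable setT (EFin \o f) ->
  mu.-integrable setT (EFin \o (f \_ (~` N))) /\
  \int[cmu]_x (f x)%:E = \int[mu]_x ((f \_ (~` N)) x)%:E.
Proof.
move=> mf mN N0 mfN intf.
pose phi : caratheodory_type ext -> T := id.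
have mphi : measurable_fun setT phi.
  by move=> _ Y mY; rewrite setTI; exact: caratheodory_measurable_mu_ext.
pose g := f \_ (~` N).
have mg : measurable_fun setT g.
  by apply/(measurable_restrictT _ _).1 => //; exact: measurableC.
have ae : ae_eq cmu setT (EFin \o f) (EFin \o g).
  exists N; split => //.
  - exact: caratheodory_measurable_mu_ext.
  - by rewrite /= -N0 -(measurable_mu_extE mu mN).
  - move=> x /= H; apply: contrapT => Nx; apply: H => _.
    by rewrite /g patchE mem_set.
have mgE : measurable_fun setT (EFin \o g : caratheodory_type ext -> \bar R).
  by apply/measurable_EFinP; exact: caratheodory_measurable_funT.
have mfE : measurable_fun setT (EFin \o f : caratheodory_type ext -> \bar R).
  exact/measurable_EFinP.
have intg : cmu.-integrable setT (EFin \o g).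
  apply: le_integrable intf => // x _ /=; rewrite lee_fin /g patchE.
  by case: ifP => //; rewrite normr0.
have := integral_pushforward mphi (proj2 (measurable_EFinP _ _) mg) intg measurableT.
have := integrable_pushforward mphi (proj2 (measurable_EFinP _ _) mg) intg measurableT.
have E A : measurable A -> pushforward cmu phi A = mu A.
  by move=> mA; exact: (measurable_mu_extE mu mA).
move=> /integrableP[mgP goo] H; split.
  apply/integrableP; split; first exact/measurable_EFinP.
  rewrite (le_lt_trans _ goo)// le_eqVlt; apply/orP; left; apply/eqP.
  by apply: eq_measure_integral => A mA _; rewrite -E.
transitivity (\int[cmu]_x (EFin \o g) x); first exact: ae_eq_integral ae.
rewrite -[LHS]H.
by apply: eq_measure_integral => A mA _; rewrite -E.
Qed.

End completion.

(** * Fubini along the lines of one coordinate direction *)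

Section fibres.
Context {R : realType}.
Notation mu := (@lebesgue_measure R).
Notation leb n := (@lebesgue R n).
Notation bor n := (borel_lebesgue R n).

Lemma ae_section_null n (A : set (measurableTypeR R * 'cV[R]_n)) :
  measurable A -> (mu \x bor n)%E A = 0%E ->
  {ae bor n, forall y, mu [set t | A (t, y)] = 0%E}.
Proof.
move=> mA A0.
pose f : measurableTypeR R * 'cV[R]_n -> \bar R := fun z => (\1_A z)%:E.
have mf : measurable_fun setT f by apply/measurable_EFinP; exact: measurable_indic.
have f0 z : (0 <= f z)%E by rewrite lee_fin.
have f_int : (\int[mu \x bor n]_z f z = 0)%E.
  by rewrite /f integral_indic// setIT; exact: A0.
have := fubini_tonelli2 (m1 := mu) (m2 := bor n) f mf f0.
rewrite f_int => /esym.
have mG := measurable_fun_fubini_tonelli_G (m1 := mu) f mf f0.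
have G0 y : (0 <= fubini_G mu f y)%E by exact: integral_ge0.
under eq_integral => y _ do rewrite -(gee0_abs (G0 y)).
move=> /(ae_eq_integral_abs _ measurableT mG).1.
apply: filterS => y /(_ I).
rewrite /fubini_G /f /cst integral_indic ?setIT//.
rewrite [X in measurable X](_ : _ = ysection A y); first exact: measurable_ysection.
by apply/seteqP; split => t; rewrite /ysection/= inE.
Qed.

Lemma ae_fibre_null n (k : 'I_n.+1) (N : set 'cV[R]_n.+1) :
  measurable N -> bor n.+1 N = 0%E ->
  {ae bor n, forall y, mu [set t | N (insert k (t, y))] = 0%E}.
Proof.
move=> mN N0; apply: (@ae_section_null _ (insert k @^-1` N)).
  by rewrite -[X in measurable X]setTI; exact: measurable_insert.
by rewrite -borel_lebesgue_insert.
Qed.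

Lemma integral_insert n (k : 'I_n.+1) (f : 'cV[R]_n.+1 -> \bar R) :
  measurable_fun setT f -> (bor n.+1).-integrable setT f ->
  (mu \x bor n)%E.-integrable setT (f \o insert k) /\
  (\int[bor n.+1]_x f x = \int[mu \x bor n]_z f (insert k z))%E.
Proof.
move=> mf intf.
have mi := @measurable_insert R n k.
have E (g : 'cV[R]_n.+1 -> \bar R) : (\int[bor n.+1]_x g x =
    \int[pushforward (mu \x bor n)%E (@insert R n k)]_x g x)%E.
  by apply: eq_measure_integral => // A mA _; exact: borel_lebesgue_insert.
have mfi : measurable_fun setT (f \o insert k) by exact: measurableT_comp.
have intfi : (mu \x bor n)%E.-integrable setT (f \o insert k).
  apply/integrableP; split => //; have /integrableP[_] := intf.
  rewrite E (ge0_integral_pushforward mi)//; exact: measurableT_comp.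
split => //; rewrite E (integral_pushforward mi)//.
Qed.

(** Fubini for functions that are only Lebesgue measurable. Each [u j] is replaced by a Borel
    function equal to it off a null set [N j]. As [J] is finite, almost every line meets all the
    [N j] in null sets, so the fibre bound passes to the Borel versions and is then integrated over
    [W]. *)
Lemma fibre_integral_bound n (k : 'I_n.+1) (J : finType)
    (u : J -> 'cV[R]_n.+1 -> R) (w : J -> R) (beta : R) (W : set 'cV[R]_n) :
  (forall j, 0 <= w j) -> 0 <= beta -> measurable W -> (bor n W < +oo)%E ->
  (forall j, measurable_fun [set: lebesgue_space R n.+1] (u j)) ->
  (forall j, (leb n.+1).-integrable setT (EFin \o u j)) ->
  (forall j x, mu.-integrable setT (fun t => (u j (insert k (t, x)))%:E)) ->
  (forall x, \sum_j w j * `|\int[mu]_t u j (insert k (t, x))| <= beta * \1_W x) ->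
  \sum_j w j * `|\int[leb n.+1]_x u j x| <= beta * fine (bor n W).
Proof.
move=> w0 b0 mW Woo mu_ intu intfib fib.
have sf := sigma_finiteT (bor n.+1).
have /boolp.choice[N HN] : forall j, exists N, [/\ measurable N, bor n.+1 N = 0%E &
    measurable_fun (~` N) (u j)].
  by move=> j; exact: (caratheodory_measurable_fun_borel sf (mu_ j)).
pose u' j := u j \_ (~` N j).
have mu' j : measurable_fun setT (u' j).
  have [mN _ mf] := HN j.
  by apply/(measurable_restrictT _ _).1 => //; exact: measurableC.
pose H j y := (\int[mu]_t (u' j (insert k (t, y)))%:E)%E.
have intE j : (mu \x bor n)%E.-integrable setT (EFin \o u' j \o insert k) /\
    (\int[leb n.+1]_x (u j x)%:E = \int[bor n]_y H j y)%E.
  have [mN N0 mf] := HN j.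
  have [i1 e1] := integral_completed (mu_ j) mN N0 mf (intu j).
  have [|i2 e2] := @integral_insert n k (EFin \o u' j) _ i1.
    exact/measurable_EFinP.
  split => //; rewrite [LHS]e1 [LHS]e2.
  by rewrite -(integral21_prod_meas1 i2).
have mH j : measurable_fun setT (H j).
  by have [i2 _] := intE j; exact: (measurable_fubini_G i2).
have aeH : {ae bor n, forall y, forall j,
    H j y = (\int[mu]_t u j (insert k (t, y)))%:E}.
  apply: filter_forall => j; have [mN N0 mf] := HN j.
  apply: filterS (ae_fibre_null k mN N0) => y Ny0.
  rewrite /Rintegral fineK; last exact: integrable_fin_num.
  have msec (A : set 'cV[R]_n.+1) : measurable A ->
      measurable [set t | A (insert k (t, y))].
    move=> mA; have : measurable (ysection (insert k @^-1` A) y).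
      apply: measurable_ysection; rewrite -[X in measurable X]setTI.
      exact: measurable_insert.
    by congr measurable; apply/seteqP; split => t; rewrite /ysection/= inE.
  apply: ae_eq_integral => //.
  - apply/measurable_EFinP => _ Y mY; rewrite setTI.
    have := mu' j measurableT _ mY; rewrite setTI; exact: msec.
  - exact: (measurable_int _ (intfib j y)).
  - exists [set t | N j (insert k (t, y))]; split => //; first exact: msec.
    move=> t /= Ht; apply: contrapT => Nt; apply: Ht => _.
    by rewrite /u' patchE mem_set.
pose Phi y := (\sum_j (w j)%:E * `|H j y|)%E.
have mPhi : measurable_fun setT Phi.
  by apply: emeasurable_sum => j; apply: measurable_funeM; exact: measurableT_comp.
have Phi0 y : (0 <= Phi y)%E.
  by apply: sume_ge0 => j _; rewrite mule_ge0// lee_fin.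
pose psi y : \bar R := (beta * \1_W y)%:E.
have mpsi : measurable_fun setT psi.
  by apply/measurable_EFinP; apply: measurable_funM => //; exact: measurable_indic.
have psi0 y : (0 <= psi y)%E by rewrite lee_fin mulr_ge0.
have Phipsi : (\int[bor n]_y Phi y <= \int[bor n]_y psi y)%E.
  have [N' [mN' N'0 sub]] := aeH.
  rewrite (ge0_negligible_integral mN' measurableT mPhi)//.
  apply: (@le_trans _ _ (\int[bor n]_(y in setT `\` N') psi y)%E); last first.
    by apply: ge0_subset_integral => //; exact: measurableD.
  apply: ge0_le_integral => //.
  - exact: measurableD.
  - exact: measurable_funTS.
  - exact: measurable_funTS.
  - move=> y [_ N'y]; have Hy : forall j, H j y = (\int[mu]_t u j (insert k (t, y)))%:E.
      by apply: contrapT => Hy; apply: N'y; exact: sub.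
    rewrite /Phi (eq_bigr (fun j => (w j * `|\int[mu]_t u j (insert k (t, y))|)%:E)).
      by rewrite sumEFin lee_fin.
    by move=> j _; rewrite Hy.
have psiE : (\int[bor n]_y psi y = (beta * fine (bor n W))%:E)%E.
  rewrite /psi; under eq_integral do rewrite EFinM.
  rewrite ge0_integralZl//; last first.
    by apply/measurable_EFinP; exact: measurable_indic.
  by rewrite integral_indic// setIT EFinM fineK// ge0_fin_numE.
rewrite -lee_fin -psiE (le_trans _ Phipsi)// /Phi ge0_integral_sum//; last 2 first.
- by move=> j; apply: measurable_funeM; exact: measurableT_comp.
- by move=> j y _; rewrite mule_ge0// lee_fin.
rewrite -sumEFin; apply: lee_sum => j _.
rewrite ge0_integralZl//; last by rewrite lee_fin.
  rewrite EFinM EFin_normr_Rintegral// lee_wpmul2l ?lee_fin//.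
  have [_ ->] := intE j; exact: le_abse_integral.
exact: measurableT_comp.
Qed.
End fibres.

(** * Maps that move points along one coordinate; volumes of cubes *)

Section maps.
Context {R : realType}.
Notation mu := (@lebesgue_measure R).
Notation leb n := (@lebesgue R n).
Notation bor n := (borel_lebesgue R n).

Lemma product_null_of_sections n (A : set (measurableTypeR R * 'cV[R]_n)) :
  measurable A -> {ae bor n, forall y, mu [set t | A (t, y)] = 0%E} ->
  (mu \x bor n)%E A = 0%E.
Proof.
move=> mA A0.
pose f : measurableTypeR R * 'cV[R]_n -> \bar R := fun z => (\1_A z)%:E.
have mf : measurable_fun setT f by apply/measurable_EFinP; exact: measurable_indic.
have f0 z : (0 <= f z)%E by rewrite lee_fin.
have f_int : (\int[mu \x bor n]_z f z = (mu \x bor n)%E A)%E.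
  by rewrite /f integral_indic// setIT.
rewrite -f_int (fubini_tonelli2 (m1 := mu) (m2 := bor n) f mf f0).
have mG := measurable_fun_fubini_tonelli_G (m1 := mu) f mf f0.
have G0 y : (0 <= fubini_G mu f y)%E by exact: integral_ge0.
under eq_integral => y _ do rewrite -(gee0_abs (G0 y)).
apply/(ae_eq_integral_abs _ measurableT mG).2.
apply: filterS A0 => y Ay _.
rewrite /fubini_G /f /cst integral_indic ?setIT//.
rewrite [X in measurable X](_ : _ = ysection A y); first exact: measurable_ysection.
by apply/seteqP; split => t; rewrite /ysection/= inE.
Qed.

Lemma measurable_fun_affine n (M : 'M[R]_n) (c : 'cV[R]_n) :
  measurable_fun setT (fun x : 'cV[R]_n => M *m x + c).
Proof.
apply: measurable_fun_colvecP => i.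
under eq_fun do rewrite mxE mxE.
apply: measurable_funD => //; apply: measurable_sum => j.
by apply: measurable_funM => //; exact: measurable_coord.
Qed.

(** On each line in direction [k] the map is affine of slope [a], so one-dimensional scaling makes
    almost every section of the preimage null, and Tonelli concludes. *)
Lemma single_row_null n (k : 'I_n.+1) (phi : 'cV[R]_n.+1 -> 'cV[R]_n.+1)
    (a : R) (b : 'cV[R]_n -> R) (N : set 'cV[R]_n.+1) :
  0 < a -> measurable_fun setT phi ->
  (forall t y, phi (insert k (t, y)) = insert k (a * t + b y, y)) ->
  measurable N -> bor n.+1 N = 0%E -> bor n.+1 (phi @^-1` N) = 0%E.
Proof.
move=> a0 mphi phiE mN N0.
have mpN : measurable (phi @^-1` N).
  by rewrite -[X in measurable X]setTI; exact: mphi.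
have mipN : measurable (insert k @^-1` (phi @^-1` N)).
  by rewrite -[X in measurable X]setTI; exact: measurable_insert.
rewrite (borel_lebesgue_insert k mpN); apply: product_null_of_sections => //.
apply: filterS (ae_fibre_null k mN N0) => y Ny.
have mNy : measurable [set t | N (insert k (t, y))].
  have : measurable (ysection (insert k @^-1` N) y).
    apply: measurable_ysection; rewrite -[X in measurable X]setTI.
    exact: measurable_insert.
  by congr measurable; apply/seteqP; split => t; rewrite /ysection/= inE.
have := @lebesgue_measure_affine R a (b y) _ a0 mNy; rewrite Ny mule0 => <-.
by congr (mu _); apply/seteqP; split => t /=; rewrite phiE.
Qed.

Lemma Lebesgue_measurable_single_row n (k : 'I_n.+1)
    (phi : 'cV[R]_n.+1 -> 'cV[R]_n.+1) (a : R) (b : 'cV[R]_n -> R)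
    (f : 'cV[R]_n.+1 -> R) :
  0 < a -> measurable_fun setT phi ->
  (forall t y, phi (insert k (t, y)) = insert k (a * t + b y, y)) ->
  measurable_fun [set: lebesgue_space R n.+1] f ->
  measurable_fun [set: lebesgue_space R n.+1] (f \o phi).
Proof.
move=> a0 mphi phiE mf; apply: caratheodory_measurable_fun_comp => //.
- exact: sigma_finiteT.
- by move=> N; exact: single_row_null phiE.
Qed.

Lemma lebesgueE n (A : set 'cV[R]_n) : measurable A -> leb n A = bor n A.
Proof. exact: measurable_mu_extE. Qed.

Lemma measurable_lebesgue n (A : set 'cV[R]_n) : measurable A ->
  measurable (A : set (lebesgue_space R n)).
Proof. exact: caratheodory_measurable_mu_ext. Qed.

Lemma borel_lebesgue_cube n (B : 'I_n -> set (measurableTypeR R)) (l : R) :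
  (forall i, measurable (B i)) -> (forall i, mu (B i) = l%:E) ->
  bor n (box B) = (l ^+ n)%:E.
Proof.
move=> mB Bl; rewrite borel_lebesgue_box//.
under eq_bigr do rewrite Bl.
by rewrite prodEFin prodr_const card_ord.
Qed.

Lemma cube_setE n (Q : cube R n) : cube_set Q =
  box (fun i => `[corner Q i ord0, corner Q i ord0 + side Q[%classic).
Proof. by []. Qed.

Lemma volumeE n (Q : cube R n) : 0 < side Q -> volume Q = side Q ^+ n.
Proof.
move=> Q0; rewrite /volume cube_setE.
have mB i : measurable (`[corner Q i ord0, corner Q i ord0 + side Q[%classic :
    set (measurableTypeR R)) by exact: measurable_itv.
rewrite lebesgueE; last exact: measurable_box.
rewrite (@borel_lebesgue_cube _ _ (side Q))// => i.
by rewrite lebesgue_measure_itv/= lte_fin ltrDl Q0 -EFinB addrAC subrr add0r.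
Qed.

End maps.

(** * Almost orthogonality *)

Section gram.
Context d (T : measurableType d) (R : realType) (mu : {measure set T -> \bar R}).

Definition sq_integrable (f : T -> R) :=
  measurable_fun setT f /\ mu.-integrable setT (EFin \o (fun x => f x ^+ 2)).

Lemma normrM_le_sqr (a b : R) : `|a * b| <= a ^+ 2 + b ^+ 2.
Proof.
rewrite ler_norml; apply/andP; split.
  by have := sqr_ge0 (a + b); have := sqr_ge0 a; have := sqr_ge0 b; nra.
by have := sqr_ge0 (a - b); have := sqr_ge0 a; have := sqr_ge0 b; nra.
Qed.

Lemma sq_integrableM f g : sq_integrable f -> sq_integrable g ->
  mu.-integrable setT (EFin \o (fun x => f x * g x)).
Proof.
move=> [mf f2] [mg g2].
apply: (le_integrable measurableT _ _ (integrableD measurableT f2 g2)).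
  by apply/measurable_EFinP; exact: measurable_funM.
move=> x _ /=; rewrite lee_fin [leRHS]ger0_norm ?addr_ge0 ?sqr_ge0//.
exact: normrM_le_sqr.
Qed.

Lemma sq_integrableZ c f : sq_integrable f -> sq_integrable (fun x => c * f x).
Proof.
move=> [mf f2]; split; first exact: measurable_funM.
rewrite (_ : _ \o _ = EFin \o (fun x => c ^+ 2 * f x ^+ 2)).
  exact: (integrableZl measurableT (c ^+ 2) f2).
by apply/funext => x /=; rewrite exprMn.
Qed.

Lemma sq_integrableB f g : sq_integrable f -> sq_integrable g ->
  sq_integrable (fun x => f x - g x).
Proof.
move=> [mf f2] [mg g2]; split; first exact: measurable_funB.
have i2 := integrableZl measurableT 2 (integrableD measurableT f2 g2).
apply: (le_integrable measurableT _ _ i2).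
  by apply/measurable_EFinP; apply: measurable_funX; exact: measurable_funB.
move=> x _ /=; rewrite lee_fin [leLHS]ger0_norm ?sqr_ge0// [leRHS]ger0_norm.
  by have := sqr_ge0 (f x + g x); nra.
by rewrite mulr_ge0// addr_ge0 ?sqr_ge0.
Qed.

Lemma Rintegral_lincomb (J : finType) (c : J -> R) (f : J -> T -> R) :
  (forall j, mu.-integrable setT (EFin \o f j)) ->
  mu.-integrable setT (EFin \o (fun x => \sum_j c j * f j x)) /\
  \int[mu]_x (\sum_j c j * f j x) = \sum_j c j * \int[mu]_x f j x.
Proof.
move=> intf.
have cf j : mu.-integrable setT (EFin \o (fun x => c j * f j x)).
  exact: (integrableZl measurableT (c j) (intf j)).
elim: (index_enum J) => [|j s [i1 e1]].
  split; last first.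
    by under eq_Rintegral do rewrite big_nil; rewrite big_nil Rintegral_cst// mul0r.
  under [X in EFin \o X]eq_fun do rewrite big_nil.
  exact: integrable0.
split.
  under [X in EFin \o X]eq_fun do rewrite big_cons.
  exact: (integrableD measurableT (cf j) i1).
under eq_Rintegral do rewrite big_cons.
by rewrite RintegralD// big_cons e1 RintegralZl.
Qed.

(* Schur's test applied to the Gram matrix. *)
Lemma gram_schur (J : finType) (psi : J -> T -> R) (w : J -> R) (B : R) (h : T -> R) :
  sq_integrable h -> (forall j, sq_integrable (psi j)) ->
  (forall j, 0 < w j) -> 0 <= B ->
  (forall i, \sum_j `|\int[mu]_x (psi i x * psi j x)| * w j <= B * w i) ->
  \sum_j (\int[mu]_x (h x * psi j x)) ^+ 2 <= B * \int[mu]_x (h x ^+ 2).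
Proof.
move=> hL psiL w0 B0 rows.
set H := \int[mu]_x (h x ^+ 2).
pose c j := \int[mu]_x (h x * psi j x).
pose g i j := \int[mu]_x (psi i x * psi j x).
set S := (X in X <= _); have SE : S = \sum_j c j * c j.
  by apply: eq_bigr => j _; rewrite expr2.
have S0 : 0 <= S by apply: sumr_ge0 => j _; exact: sqr_ge0.
(* Duality: [p] pairs with [h] to [S], and Schur's test bounds the squared norm of [p] by [B * S].
   Nonnegativity of the squared norm of [h - t * p] for a suitable [t] then gives [S <= B * H]. *)
pose p x := \sum_j c j * psi j x.
have [ihp ehp] : mu.-integrable setT (EFin \o (fun x => h x * p x)) /\
    \int[mu]_x (h x * p x) = S.
  have [] := Rintegral_lincomb c (fun j => sq_integrableM hL (psiL j)).
  rewrite (_ : (fun x => \sum_j _) = (fun x => h x * p x)).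
    by rewrite -SE.
  by apply/funext => x; rewrite mulr_sumr; apply: eq_bigr => j _; rewrite mulrCA.
have psip i : mu.-integrable setT (EFin \o (fun x => psi i x * p x)) /\
    \int[mu]_x (psi i x * p x) = \sum_j c j * g i j.
  have [] := Rintegral_lincomb c (fun j => sq_integrableM (psiL i) (psiL j)).
  rewrite (_ : (fun x => \sum_j _) = (fun x => psi i x * p x))//.
  by apply/funext => x; rewrite mulr_sumr; apply: eq_bigr => j _; rewrite mulrCA.
have [ipp epp] : mu.-integrable setT (EFin \o (fun x => p x ^+ 2)) /\
    \int[mu]_x (p x ^+ 2) = \sum_i c i * \sum_j c j * g i j.
  have [] := Rintegral_lincomb c (fun i => (psip i).1).
  rewrite (_ : (fun x => \sum_j _) = (fun x => p x ^+ 2)).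
    move=> i1 ->; split => //; apply: eq_bigr => i _.
    by have [_ ->] := psip i.
  apply/funext => x; rewrite expr2 {2}/p mulr_suml; apply: eq_bigr => j _.
  by rewrite mulrA.
have gC i j : g i j = g j i by apply: eq_Rintegral => x _; rewrite mulrC.
have ppS : \int[mu]_x (p x ^+ 2) <= B * S.
  rewrite epp.
  apply: (@le_trans _ _ (\sum_i \sum_j (`|g i j| * (c i ^+ 2 * w j / w i) / 2 +
      `|g j i| * (c j ^+ 2 * w i / w j) / 2))).
    apply: ler_sum => i _; rewrite mulr_sumr; apply: ler_sum => j _.
    rewrite (gC j i) -mulrDl -mulrDr.
    (* Weighted arithmetic-geometric mean inequality. After summation, the symmetry of [g] makes its
       two halves the same weighted row sum. *)
    have key : `|c i * c j| * 2 <= c i ^+ 2 * w j / w i + c j ^+ 2 * w i / w j.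
      rewrite -(ler_pM2r (mulr_gt0 (w0 i) (w0 j))).
      have -> : (c i ^+ 2 * w j / w i + c j ^+ 2 * w i / w j) * (w i * w j) =
          (c i * w j) ^+ 2 + (c j * w i) ^+ 2.
        by field; rewrite !gt_eqF.
      have := sqr_ge0 (`|c i| * w j - `|c j| * w i).
      rewrite -(real_normK (num_real (c i * w j))) -(real_normK (num_real (c j * w i))).
      rewrite !normrM !(gtr0_norm (w0 _)); nra.
    rewrite (le_trans (ler_norm _))// !normrM mulrA -normrM mulrC -mulrA ler_wpM2l//.
    by rewrite ler_pdivlMr.
  under eq_bigr do rewrite big_split/=.
  rewrite big_split/= [X in _ + X]exchange_big/=.
  rewrite SE -mulr2n -[leLHS]mulr_natl !mulr_sumr; apply: ler_sum => i _.
  rewrite (eq_bigr (fun j => c i ^+ 2 / w i / 2 * (`|g i j| * w j))); last first.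
    by move=> j _; field; rewrite gt_eqF.
  rewrite -mulr_sumr; have ci : 0 <= c i ^+ 2 / w i / 2.
    by rewrite !divr_ge0 ?sqr_ge0// ltW.
  apply: (le_trans (ler_wpM2l (ler0n _ 2) (ler_wpM2l ci (rows i)))).
  rewrite [leLHS](_ : _ = B * (c i * c i))//.
  by field; rewrite gt_eqF.
have [mh ih] := hL.
have quad t : 0 <= H - 2 * t * S + t ^+ 2 * \int[mu]_x (p x ^+ 2).
  have -> : H - 2 * t * S + t ^+ 2 * \int[mu]_x (p x ^+ 2) =
      \int[mu]_x ((h x - t * p x) ^+ 2).
    have i1 : mu.-integrable setT (EFin \o (fun x => 2 * t * (h x * p x))).
      exact: (integrableZl measurableT (2 * t) ihp).
    have i2 : mu.-integrable setT (EFin \o (fun x => t ^+ 2 * p x ^+ 2)).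
      exact: (integrableZl measurableT (t ^+ 2) ipp).
    rewrite -ehp -RintegralZl// -[X in _ + X]RintegralZl// -RintegralB// -RintegralD//.
      by apply: eq_Rintegral => x _; ring.
    exact: (integrableB measurableT ih i1).
  by apply: Rintegral_ge0 => x _; exact: sqr_ge0.
have H0 : 0 <= H by apply: Rintegral_ge0 => x _; exact: sqr_ge0.
have [S00|Sneq] := eqVneq S 0; first by rewrite S00 mulr_ge0.
have Sgt : 0 < S by rewrite lt_neqAle eq_sym Sneq.
(* If [B = 0] then the quadratic term is at most 0, and [t = (H + 1) / S] would make the expression
   at most [- H - 2]. *)
have [BE|Bneq] := eqVneq B 0.
  have := quad ((H + 1) / S); move: ppS; rewrite BE mul0r => pp.
  have -> : 2 * ((H + 1) / S) * S = 2 * (H + 1) by field.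
  have := sqr_ge0 ((H + 1) / S) => t0.
  have : ((H + 1) / S) ^+ 2 * \int[mu]_x p x ^+ 2 <= 0 by rewrite mulr_ge0_le0.
  lra.
have Bgt : 0 < B by rewrite lt_neqAle eq_sym Bneq.
(* [B^-1] minimises [H - 2 * t * S + t ^+ 2 * (B * S)] in [t]. *)
have := quad B^-1.
have : B^-1 ^+ 2 * \int[mu]_x p x ^+ 2 <= B^-1 * S.
  rewrite (le_trans (ler_wpM2l (sqr_ge0 _) ppS))// expr2 -mulrA (mulrA B^-1 B).
  by rewrite mulVf// mul1r.
move=> q1 q2; rewrite -ler_pdivrMl//; lra.
Qed.

End gram.

(** * Reduction to elementary matrices *)

Lemma dist_bounds (R : realType) (x y e : R) :
  `|x - y| <= e -> y - e <= x /\ x <= y + e.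
Proof. by rewrite ler_distl => /andP. Qed.

Section affine.
Context {R : realType}.
Variable n : nat.
Implicit Types (A : 'M[R]_n.+1) (c z x y : 'cV[R]_n.+1) (m : 'I_n.+1).

Definition aff c A z x := c + A *m (x - c) + z.

Definition elem_row m A : 'M[R]_n.+1 :=
  \matrix_(i, l) if i == m then A m l else (i == l)%:R.

(** [A] times the inverse of [elem_row m A]: the column elimination that turns row [m] into a row of
    the identity. *)
Definition pivot m A : 'M[R]_n.+1 := \matrix_(i, l)
  if i == m then (i == l)%:R
  else if l == m then A i m / A m m else A i l - A i m / A m m * A m l.

(** The solution of [pivot m A *m elem_shift m z + pivot_shift m A z = z], so that the translations
    compose correctly in [aff_pivot]. *)
Definition pivot_shift m A z : 'cV[R]_n.+1 :=
  \col_i if i == m then 0 else z i ord0 - z m ord0 * pivot m A i m.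

Definition elem_shift m z : 'cV[R]_n.+1 := z m ord0 *: delta_mx m ord0.

Lemma pivot_mul m A : A m m != 0 -> pivot m A *m elem_row m A = A.
Proof.
move=> Amm; apply/matrixP => i l; rewrite !mxE (bigD1 m)//= !mxE eqxx.
have -> : \sum_(j < n.+1 | j != m) pivot m A i j * elem_row m A j l =
    if l == m then 0 else pivot m A i l.
  case: eqP => [->|/eqP lm].
    by rewrite big1// => j jm; rewrite [elem_row _ _ _ _]mxE !(negbTE jm) mulr0.
  rewrite (bigD1 l)//= [elem_row _ _ _ _]mxE (negbTE lm) eqxx mulr1 big1 ?addr0//.
  by move=> j /andP[jm jl]; rewrite [elem_row _ _ _ _]mxE (negbTE jm) (negbTE jl) mulr0.
rewrite !mxE; have [->|im] := eqVneq i m.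
  by rewrite mul1r; case: eqVneq => [_|lm]; rewrite ?addr0// eq_sym (negbTE lm) addr0.
by case: eqVneq => [->|lm]; rewrite ?addr0 ?divfK// addrC subrK.
Qed.

(** In the expansion along row [m], the minor of the diagonal entry is the identity and every other
    minor has a zero row. *)
Lemma det_elem_row m A : \det (elem_row m A) = A m m.
Proof.
rewrite (expand_det_row _ m) (bigD1 m)//= big1 ?addr0 => [|j jm].
  rewrite [elem_row _ _ _ _]mxE eqxx /cofactor addnn -signr_odd odd_double expr0 mul1r.
  rewrite (_ : row' m _ = 1%:M) ?det1 ?mulr1//; apply/matrixP => i l.
  by rewrite !mxE eq_sym (negbTE (neq_lift _ _)) (inj_eq lift_inj).
rewrite /cofactor; case: (unliftP m j) jm => [i0 ->|->]; last by rewrite eqxx.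
move=> _; rewrite [\det _](_ : _ = 0) ?mulr0//.
rewrite (expand_det_row _ i0) big1// => l _.
by rewrite !mxE eq_sym (negbTE (neq_lift _ _)) (negbTE (neq_lift _ _)) mul0r.
Qed.

Lemma aff_pivot m A c z x : A m m != 0 ->
  aff c A z x = aff c (pivot m A) (pivot_shift m A z)
                  (aff c (elem_row m A) (elem_shift m z) x).
Proof.
move=> Amm; have -> : aff c (pivot m A) (pivot_shift m A z)
    (aff c (elem_row m A) (elem_shift m z) x) =
  c + pivot m A *m (elem_row m A *m (x - c) + elem_shift m z) + pivot_shift m A z.
  by rewrite {1}/aff; congr (_ + _ *m _ + _); rewrite /aff -(addrA c) addrAC subrr add0r.
rewrite /aff mulmxDr mulmxA pivot_mul// -!addrA; congr (_ + (_ + _)).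
apply/colP => i; rewrite !mxE (bigD1 m)//= big1 ?addr0.
  rewrite !mxE !eqxx mulr1; have [->|im] := eqVneq i m; first by rewrite mul1r addr0.
  by rewrite (mulrC (z m _)) addrC subrK.
by move=> j jm; rewrite !mxE (negbTE jm) mulr0 mulr0.
Qed.

Section near_identity.
Variables (A : 'M[R]_n.+1) (z : 'cV[R]_n.+1) (m : 'I_n.+1) (eps l : R).
Hypotheses (e2 : eps <= 1 / 2) (l0 : 0 <= l).
Hypothesis Aeps : forall i j, `|A i j - (i == j)%:R| <= eps.
Hypothesis zeps : forall i, `|z i ord0| <= eps * l.

Lemma near_identity_pivot : 1 / 2 <= A m m /\ A m m <= 3 / 2.
Proof.
have := Aeps m m; rewrite eqxx => H.
have /dist_bounds[h1 h2] : `|A m m - 1| <= eps := H.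
by have e2h : eps <= 1 / 2 := e2; split; lra.
Qed.

Let a0 : 0 < A m m.
Proof. by have [h _] := near_identity_pivot; rewrite (lt_le_trans _ h)// divr_gt0. Qed.

Let e0 : 0 <= eps. Proof. by rewrite (le_trans _ (Aeps m m)). Qed.

Let ratio i : i != m -> `|A i m / A m m| <= 2 * eps.
Proof.
move=> im; have := Aeps i m; rewrite (negbTE im) subr0 normrM normfV (gtr0_norm a0) => Aim.
rewrite ler_pdivrMr//; have [h _] := near_identity_pivot.
by have := e0; have := e2; nra.
Qed.

(** As [A m m >= 1 / 2], the multipliers [A i m / A m m] are at most [2 * eps], and
    [2 * eps * eps <= eps]: one elimination at most doubles the deviation from the identity. *)
Lemma near_identity_pivot_mx i j : `|pivot m A i j - (i == j)%:R| <= 2 * eps.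
Proof.
rewrite mxE; have [->|im] := eqVneq i m; first by rewrite subrr normr0 mulr_ge0.
have [->|jm] := eqVneq j m; first by rewrite (negbTE im) subr0 ratio.
have -> : A i j - A i m / A m m * A m j - (i == j)%:R =
  (A i j - (i == j)%:R) - A i m / A m m * A m j by ring.
rewrite (le_trans (ler_normB _ _))// normrM.
have := Aeps m j; rewrite eq_sym (negbTE jm) subr0 => Amj.
have P := ler_pM (normr_ge0 _) (normr_ge0 _) (ratio im) Amj.
have E : 2 * eps * eps <= eps by have := e0; have := e2; nra.
by rewrite mulrDl mul1r lerD// (le_trans P).
Qed.

Lemma near_identity_pivot_shift i : `|pivot_shift m A z i ord0| <= 2 * eps * l.
Proof.
rewrite mxE; have [_|im] := eqVneq i m; first by rewrite normr0 !mulr_ge0.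
rewrite mxE (negbTE im) eqxx (le_trans (ler_normB _ _))// normrM.
have P := ler_pM (normr_ge0 _) (normr_ge0 _) (zeps m) (ratio im).
have el := mulr_ge0 e0 l0.
have E : eps * l * (2 * eps) <= eps * l by have := e2; nra.
by rewrite -mulrA mulrDl mul1r lerD// (le_trans P).
Qed.

Hypothesis Atriv : forall i j : 'I_n.+1, (m < i)%N -> A i j = (i == j)%:R.
Hypothesis ztriv : forall i : 'I_n.+1, (m < i)%N -> z i ord0 = 0.

(** Elimination runs from the last row upwards: it trivialises row [m] and leaves the trivial rows
    after it unchanged. *)
Lemma pivot_trivial (i j : 'I_n.+1) : (m <= i)%N -> pivot m A i j = (i == j)%:R.
Proof.
rewrite leq_eqVlt => /orP[/eqP/val_inj <-|mi]; first by rewrite mxE eqxx.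
have im : i != m by rewrite -val_eqE/= gtn_eqF.
rewrite mxE (negbTE im) (Atriv m mi) (negbTE im) mul0r mul0r subr0 Atriv//.
by case: eqVneq => // ->; rewrite (negbTE im).
Qed.

Lemma pivot_shift_trivial (i : 'I_n.+1) : (m <= i)%N -> pivot_shift m A z i ord0 = 0.
Proof.
rewrite leq_eqVlt => /orP[/eqP/val_inj <-|mi]; first by rewrite mxE eqxx.
have im : i != m by rewrite -val_eqE/= gtn_eqF.
rewrite mxE (negbTE im) ztriv// pivot_trivial 1?ltnW// (negbTE im) mulr0 subr0//.
Qed.

End near_identity.
End affine.

Section lebesgue_bounded.
Context {R : realType}.
Notation mu := (@lebesgue_measure R).
Notation leb n := (@lebesgue R n).
Notation bor n := (borel_lebesgue R n).

Definition ball_inf n (c : 'I_n -> R) (r : R) : set 'cV[R]_n :=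
  [set x | forall i, `|x i ord0 - c i| <= r].

Lemma ball_infE n (c : 'I_n -> R) r :
  ball_inf c r = box (fun i => `[c i - r, c i + r]%classic).
Proof.
by apply/seteqP; split => x /= h i; have := h i; rewrite /= in_itv/= ler_distl.
Qed.

Lemma measurable_ball_inf n (c : 'I_n -> R) r : measurable (ball_inf c r).
Proof. by rewrite ball_infE; apply: measurable_box => i; exact: measurable_itv. Qed.

Lemma borel_lebesgue_ball_inf n (c : 'I_n -> R) r : 0 <= r ->
  bor n (ball_inf c r) = ((2 * r) ^+ n)%:E.
Proof.
move=> r0; rewrite ball_infE; apply: borel_lebesgue_cube => i.
  exact: measurable_itv.
rewrite lebesgue_measure_itv/= lte_fin; case: ltP => h.
  by rewrite -EFinB; congr EFin; ring.
by congr EFin; lra.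
Qed.

Lemma bounded_sq_integrable n (c : 'I_n -> R) r V (f : 'cV[R]_n -> R) : 0 <= r ->
  measurable_fun [set: lebesgue_space R n] f -> (forall x, `|f x| <= V) ->
  (forall x, f x != 0 -> ball_inf c r x) -> sq_integrable (leb n) f.
Proof.
move=> r0 mf fV fc; split => //.
apply: (@integrable_bounded_support _ _ _ (leb n) (ball_inf c r) (V ^+ 2)).
- by apply: measurable_lebesgue; exact: measurable_ball_inf.
- have ball_fin : (bor n (ball_inf c r) < +oo)%E.
    by rewrite borel_lebesgue_ball_inf// ltry.
  by apply: le_lt_trans ball_fin; rewrite -(lebesgueE (measurable_ball_inf c r)).
- exact: measurable_funX.
- by move=> x; rewrite normrX lerXn2r// nnegrE (le_trans _ (fV x)).
- by move=> x; rewrite expf_eq0/=; exact: fc.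
Qed.

End lebesgue_bounded.

(** * Bessel bound for families that are atoms on parallel lines *)

Section atomic_families.
Context {R : realType}.
Notation mu := (@lebesgue_measure R).
Notation leb n := (@lebesgue R n).
Notation bor n := (borel_lebesgue R n).
Variables (n N M L : nat) (k : 'I_n.+1) (V kappa : R).
Let I := ('I_M * {ffun 'I_n.+1 -> 'I_M})%type.
Let s (i : I) : R := scale N i.1.
Let cen (i : I) (m : 'I_n.+1) : R := gcenter N i.1 (i.2 m).
Variable G : I -> 'cV[R]_n.+1 -> R.
Hypotheses (V1 : 1 <= V) (k0 : 0 <= kappa).
Hypothesis measG : forall i, measurable_fun [set: lebesgue_space R n.+1] (G i).
Hypothesis atomG : forall i y, exists v,
  atom (cen i k) (L%:R * s i) V (kappa * s i) v (fun t => G i (insert k (t, y))).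
Hypothesis suppG : forall i t y, G i (insert k (t, y)) != 0 -> forall j,
  `|y j ord0 - cen i (lift k j)| <= L%:R * s i.

(** The factors come from counting positions on a line, from summing over scales, and from the
    measure of the set of lines that can meet the support of an atom of scale 1. *)
Definition atomic_const : R :=
  ((2 * (2 * L).+1)%:R * V) ^+ n.+1 * geom * (2 * L%:R) ^+ n.

Lemma atomic_const_ge0 : 0 <= atomic_const.
Proof.
have V0 : 0 <= V by exact: le_trans V1.
have b0 : 0 <= (2 * (2 * L).+1)%:R * V by rewrite mulr_ge0.
have l0 : 0 <= 2 * L%:R :> R by rewrite mulr_ge0.
by rewrite /atomic_const mulr_ge0 ?exprn_ge0// mulr_ge0 ?exprn_ge0// geom_ge0.
Qed.

Let s_gt0 i : 0 < s i. Proof. exact: scale_gt0. Qed.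
Let Ls_ge0 i : 0 <= L%:R * s i. Proof. by rewrite mulr_ge0// ltW. Qed.

Let normG i x : `|G i x| <= V.
Proof.
rewrite -(insertK k x); have [v [vG Gs _ _]] := atomG i (\col_j x (lift k j) ord0).
exact: (dominates_support_normr vG Gs).
Qed.

Let ballG i x : G i x != 0 -> ball_inf (cen i) (L%:R * s i) x.
Proof.
rewrite -(insertK k x) => Gx m; have [v [_ Gs _ _]] := atomG i (\col_j x (lift k j) ord0).
case: (unliftP k m) => [j ->|->]; last by rewrite insert_at; exact: Gs.
by rewrite insert_lift; exact: suppG Gx _.
Qed.

Let sqG i : sq_integrable (leb n.+1) (G i).
Proof. exact: bounded_sq_integrable (Ls_ge0 i) (measG i) (normG i) (@ballG i). Qed.

(** Only lines through the support box of [G i] contribute; their base points form an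
    [n]-dimensional box of side [2 * (L * s i)], over which [fibre_row_sum] is integrated. *)
Let row_sum i :
  \sum_j (Num.sqrt (s j))^-1 * `|\int[leb n.+1]_x (G i x * G j x)| <=
  kappa * ((2 * (2 * L).+1)%:R * V) ^+ n.+1 * geom * Num.sqrt (s i) *
  (2 * (L%:R * s i)) ^+ n.
Proof.
have V0 : 0 <= V by exact: le_trans V1.
have geom0 := @geom_ge0 R.
pose W := ball_inf (fun j => cen i (lift k j)) (L%:R * s i).
have WE : bor n W = ((2 * (L%:R * s i)) ^+ n)%:E by exact: borel_lebesgue_ball_inf.
have -> : (2 * (L%:R * s i)) ^+ n = fine (bor n W) by rewrite WE.
apply: (fibre_integral_bound (k := k)
  (u := fun j x => G i x * G j x) (w := fun j => (Num.sqrt (s j))^-1)).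
- by move=> j; rewrite invr_ge0 sqrtr_ge0.
- by rewrite mulr_ge0 ?sqrtr_ge0// mulr_ge0// mulr_ge0// exprn_ge0// mulr_ge0.
- exact: measurable_ball_inf.
- by rewrite WE ltry.
- by move=> j; exact: measurable_funM.
- by move=> j; exact: sq_integrableM.
- move=> j y; have [v [vG Gs _ _]] := atomG i y; have [v' [vG' Gs' _ _]] := atomG j y.
  apply: (@integrable_line _ (cen i k) (L%:R * s i) (V * V)).
  + by apply: measurable_funM; [exact: dominates_measurable vG|exact: dominates_measurable vG'].
  + by move=> t; rewrite normrM ler_pM.
  + by move=> t; rewrite mulf_eq0 negb_or => /andP[/Gs].
- move=> y; rewrite indicE; have [yW|yW] := boolP (y \in W); last first.
    rewrite mulr0 le_eqVlt big1 ?eqxx// => j _.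
    rewrite /Rintegral integral0_eq ?normr0 ?mulr0// => t _.
    rewrite (_ : G i _ = 0) ?mul0r//; apply/eqP/negPn/negP => /suppG H.
    by move/negP: yW; apply; rewrite inE => j'; exact: H.
  rewrite mulr1; have /boolp.choice[v Hv] := fun j => atomG j y.
  apply: (@fibre_row_sum R n.+1 N M L k V kappa (fun m => insert k (0, y) m ord0)
    (fun j t => G j (insert k (t, y))) v) => // j t Gj m mk.
  case: (unliftP k m) mk => [m' ->|->]; last by rewrite eqxx.
  by rewrite insert_lift => _; exact: suppG Gj _.
Qed.

Lemma atomic_bessel (h : 'cV[R]_n.+1 -> R) : sq_integrable (leb n.+1) h ->
  \sum_i (\int[leb n.+1]_x (h x * G i x)) ^+ 2 / s i ^+ n.+1 <=
  atomic_const * kappa * \int[leb n.+1]_x (h x ^+ 2).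
Proof.
move=> hL.
pose sg i := Num.sqrt (s i).
have sg0 i : 0 < sg i by rewrite sqrtr_gt0.
have sgs i : sg i ^+ 2 = s i by rewrite sqr_sqrtr// ltW.
(* The normalisation by the square root of the volume, moved from the coefficients into the
   functions. *)
pose lam i := (sg i ^+ n.+1)^-1.
have lam0 i : 0 <= lam i by rewrite invr_ge0 exprn_ge0 ?ltW.
have lhs i : (\int[leb n.+1]_x (h x * G i x)) ^+ 2 / s i ^+ n.+1 =
    (\int[leb n.+1]_x (h x * (lam i * G i x))) ^+ 2.
  under [in RHS]eq_Rintegral do rewrite mulrCA.
  rewrite RintegralZl//; last exact: sq_integrableM.
  by rewrite [in RHS]exprMn mulrC /lam exprVn -(sgs i) -!exprM mulnC.
under eq_bigr do rewrite lhs.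
(* The weights [l(Q) ^ (n / 2)] compensate for the [n]-dimensional measure of
   the set of lines that meet [Q]. *)
apply: (gram_schur (w := fun i => sg i ^+ n) hL).
- by move=> i; exact: sq_integrableZ.
- by move=> i; rewrite exprn_gt0.
- by rewrite mulr_ge0// atomic_const_ge0.
- move=> i; under eq_bigr => j _.
    under eq_Rintegral do rewrite mulrACA.
    rewrite RintegralZl//; last exact: sq_integrableM.
    rewrite normrM (ger0_norm (mulr_ge0 (lam0 _) (lam0 _))).
    over.
  rewrite (eq_bigr (fun j => lam i * ((sg j)^-1 * `|\int[leb n.+1]_x (G i x * G j x)|))).
    rewrite -mulr_sumr; apply: (le_trans (ler_wpM2l (lam0 i) (row_sum i))).
    have -> : (2 * (L%:R * s i)) ^+ n = (2 * L%:R) ^+ n * (sg i ^+ n * sg i ^+ n).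
      by rewrite mulrA -(sgs i) -(exprMn n (sg i) (sg i)) -expr2 [LHS]exprMn.
    have sgn0 : sg i ^+ n != 0 by rewrite expf_neq0// gt_eqF.
    have sgi0 : sg i != 0 by rewrite gt_eqF.
    rewrite -/(sg i) /lam /atomic_const exprS le_eqVlt; apply/orP; left; apply/eqP.
    by field; rewrite sgn0 sgi0.
  move=> j _; rewrite /lam !exprS; field.
  by rewrite !expf_neq0 ?gt_eqF.
Qed.

End atomic_families.

(** * One-row affine maps acting on bumps *)

Section bumps.
Context {R : realType}.
Notation mu := (@lebesgue_measure R).
Notation leb n := (@lebesgue R n).
Variable n : nat.
Implicit Types (F : 'cV[R]_n.+1 -> R) (c : 'cV[R]_n.+1).

(** Real-valued counterpart of [SNBV_on]. All directions [v] are kept, since an affine map changes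
    the direction of a line, and the support is a box of free radius, since composition enlarges
    it. *)
Definition bump c (r : R) F :=
  [/\ measurable_fun [set: lebesgue_space R n.+1] F,
      forall v y, exists w, dominates 1 w (fun t => F (y + t *: v)) &
      forall x, F x != 0 -> forall i, `|x i ord0 - c i ord0| <= r].

Lemma insertE (m : 'I_n.+1) t (y : 'cV[R]_n) :
  insert m (t, y) = insert m (0, y) + t *: delta_mx m ord0.
Proof.
apply/colP => i; rewrite !mxE; case: (unliftP m i) => [j ->|->].
  by rewrite eq_sym (negbTE (neq_lift _ _)) mulr0 addr0.
by rewrite !eqxx mulr1 add0r.
Qed.

Lemma bump_insert c r F (m : 'I_n.+1) y : bump c r F ->
  exists w, dominates 1 w (fun t => F (insert m (t, y))).
Proof.
move=> [_ /(_ (delta_mx m ord0) (insert m (0, y)))[w Fw] _].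
by exists w; under eq_fun do rewrite insertE.
Qed.

Lemma bump_norm c r F x : bump c r F -> `|F x| <= 1.
Proof.
move=> bF; have [w Fw] := bump_insert ord0 (\col_j x (lift ord0 j) ord0) bF.
have [_ _ Fr] := bF.
rewrite -(insertK ord0 x).
apply: (dominates_support_normr (c := c ord0 ord0) (r := r) Fw) => t /Fr/(_ ord0).
by rewrite insert_at.
Qed.

Section elementary_map.
Variables (A : 'M[R]_n.+1) (z c : 'cV[R]_n.+1) (m : 'I_n.+1) (eps l : R).
Hypotheses (l0 : 0 < l) (e4 : eps * n.+2%:R <= 1 / 4).
Hypothesis Aeps : forall j, `|A m j - (m == j)%:R| <= eps.
Hypothesis zeps : `|z m ord0| <= eps * l.

Let phi := aff c (elem_row m A) (elem_shift m z).

Let e0 : 0 <= eps. Proof. by rewrite (le_trans _ (Aeps m)). Qed.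

Let e8 : eps <= 1 / 4.
Proof.
apply: le_trans e4; rewrite -[leLHS]mulr1 ler_wpM2l// ler1n//.
Qed.

Let a34 : 3 / 4 <= A m m /\ A m m <= 5 / 4.
Proof.
have := Aeps m; rewrite eqxx => H; have /dist_bounds[h1 h2] : `|A m m - 1| <= eps := H.
by have := e8; split; lra.
Qed.

Lemma elem_map_lift x j : phi x (lift m j) ord0 = x (lift m j) ord0.
Proof.
rewrite !mxE (bigD1 (lift m j))//= big1; last first.
  move=> i ij; rewrite !mxE eq_sym (negbTE (neq_lift _ _)) eq_sym (negbTE ij) mul0r//.
rewrite !mxE eq_sym (negbTE (neq_lift _ _)) eqxx mul1r addr0 mulr0 addr0.
by rewrite addrC subrK.
Qed.

Lemma elem_map_at x : phi x m ord0 = x m ord0 +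
  \sum_i (A m i - (m == i)%:R) * (x i ord0 - c i ord0) + z m ord0.
Proof.
rewrite !mxE !eqxx mulr1; congr (_ + _).
rewrite (eq_bigr (fun i => A m i * (x i ord0 - c i ord0))); last first.
  by move=> i _; rewrite !mxE eqxx.
rewrite [in RHS](eq_bigr (fun i => A m i * (x i ord0 - c i ord0) -
  (m == i)%:R * (x i ord0 - c i ord0))); last by move=> i _; rewrite mulrBl.
have E : \sum_i (m == i)%:R * (x i ord0 - c i ord0) = x m ord0 - c m ord0.
  rewrite (bigD1 m)//= eqxx mul1r big1 ?addr0// => i im.
  by rewrite eq_sym (negbTE im) mul0r.
by rewrite sumrB E; ring.
Qed.

Lemma elem_map_insert t y :
  phi (insert m (t, y)) = insert m (A m m * t + phi (insert m (0, y)) m ord0, y).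
Proof.
apply/colP => i; case: (unliftP m i) => [j ->|->].
  by rewrite elem_map_lift !insert_lift.
rewrite insert_at !elem_map_at !insert_at.
rewrite (bigD1 m)//= [in RHS](bigD1 m)//= !insert_at eqxx.
have -> : \sum_(i0 < n.+1 | i0 != m) (A m i0 - (m == i0)%:R) *
     (insert m (t, y) i0 ord0 - c i0 ord0) =
   \sum_(i0 < n.+1 | i0 != m) (A m i0 - (m == i0)%:R) *
     (insert m (0, y) i0 ord0 - c i0 ord0).
  apply: eq_bigr => j; case: (unliftP m j) => [j' ->|->]; last by rewrite eqxx.
  by rewrite !insert_lift.
by rewrite !mulr1n; ring.
Qed.

Lemma elem_map_dist (x : 'cV[R]_n.+1) (r : R) :
  (forall i, `|x i ord0 - c i ord0| <= r) ->
  `|phi x m ord0 - x m ord0| <= eps * (n.+1%:R * r + l).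
Proof.
move=> xr; rewrite elem_map_at -(addrA (x m ord0)) addrAC subrr add0r.
rewrite (le_trans (ler_normD _ _))// mulrDr lerD//.
rewrite (le_trans (ler_norm_sum _ _ _))//.
have -> : eps * (n.+1%:R * r) = \sum_(i < n.+1) eps * r.
  by rewrite sumr_const card_ord -mulr_natr; ring.
by apply: ler_sum => i _; rewrite normrM ler_pM.
Qed.

(** The coordinates other than [m] are unchanged. In coordinate [m] the off-diagonal terms and the
    shift add up to at most [L * l / 4] by [e4]. Hence [A m m] times the distance is at most
    [5 / 4 * (L * l)], and [A m m >= 3 / 4] leaves [5 / 3 <= 2]. *)
Lemma elem_map_support (x : 'cV[R]_n.+1) (L : R) : 1 <= L ->
  (forall i, `|phi x i ord0 - c i ord0| <= L * l) ->
  forall i, `|x i ord0 - c i ord0| <= 2 * L * l.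
Proof.
move=> L1 pr.
have Ll : l <= L * l by rewrite ler_peMl// ltW.
have Ll0 : 0 <= L * l by rewrite (le_trans _ Ll)// ltW.
have lift_r j : `|x (lift m j) ord0 - c (lift m j) ord0| <= L * l.
  by rewrite -elem_map_lift.
move=> i; case: (unliftP m i) => [j ->|->].
  by rewrite (le_trans (lift_r j))// -mulrA ler_peMl// ler1n.
have := pr m; rewrite elem_map_at (bigD1 m)//= eqxx mulr1n.
set S := \sum_(_ < _ | _) _.
have Sb : `|S| <= n%:R * (eps * (L * l)).
  rewrite (le_trans (ler_norm_sum _ _ _))//.
  have -> : n%:R * (eps * (L * l)) = \sum_(j < n.+1 | j != m) (eps * (L * l)).
    rewrite sumr_const -[RHS]mulr_natl; congr (_%:R * _).
    by rewrite cardC1 card_ord.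
  apply: ler_sum => j; case: (unliftP m j) => [j' -> _|->]; last by rewrite eqxx.
  by rewrite normrM ler_pM.
have -> : x m ord0 + ((A m m - 1) * (x m ord0 - c m ord0) + S) + z m ord0 - c m ord0 =
  A m m * (x m ord0 - c m ord0) + (S + z m ord0) by ring.
move=> h; have [a1 a2] := a34.
have en : (n%:R + 1) * eps <= 1 / 4.
  by rewrite (le_trans _ e4)// mulrC ler_wpM2l// natr1 ler_nat.
have Sz : `|S + z m ord0| <= L * l / 4.
  rewrite (le_trans (ler_normD _ _))//.
  have h1 : eps * l <= eps * (L * l) by rewrite ler_wpM2l.
  have h2 : (n%:R + 1) * eps * (L * l) <= 1 / 4 * (L * l) by rewrite ler_wpM2r.
  have h3 := zeps; rewrite mulrDl mul1r mulrDl in h2.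
  have h4 : n%:R * (eps * (L * l)) = n%:R * eps * (L * l) by rewrite mulrA.
  lra.
have au : `|A m m * (x m ord0 - c m ord0)| <= L * l + L * l / 4.
  have -> : A m m * (x m ord0 - c m ord0) =
    A m m * (x m ord0 - c m ord0) + (S + z m ord0) - (S + z m ord0) by rewrite addrK.
  by rewrite (le_trans (ler_normB _ _))// lerD.
have a0 : 0 < A m m by lra.
move: au; rewrite normrM (gtr0_norm a0) => au.
have : 3 / 4 * `|x m ord0 - c m ord0| <= A m m * `|x m ord0 - c m ord0|.
  by rewrite ler_wpM2r.
by rewrite -mulrA; lra.
Qed.

Lemma bump_elem_map F (L : R) : 1 <= L ->
  bump c (L * l) F -> bump c (2 * L * l) (F \o phi).
Proof.
move=> L1 [mF Fl Fr]; have [a1 a2] := a34; split.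
- apply: (@Lebesgue_measurable_single_row R n m phi (A m m)
    (fun y => phi (insert m (0, y)) m ord0)) => //.
  + by lra.
  + rewrite (_ : phi = fun x => elem_row m A *m x +
      (c - elem_row m A *m c + elem_shift m z)).
      exact: measurable_fun_affine.
    apply/funext => x; rewrite /phi /aff mulmxBr addrC.
    by rewrite [in RHS]addrA [in RHS]addrA addrC; congr (_ + _); rewrite addrA (addrC c).
  + exact: elem_map_insert.
(* An affine map sends lines to lines: the bound is that of [F] in direction [elem_row m A *m v]. *)
- move=> v y; have [w Fw] := Fl (elem_row m A *m v) (phi y).
  exists w; congr dominates: Fw; apply/funext => t /=; congr F.
  by rewrite /phi /aff [y + _ - c]addrAC (mulmxDr _ (y - c)) -scalemxAr (addrA c) (addrAC _ (t *: _)).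
- by move=> x /Fr px; exact: elem_map_support.
Qed.

(** [atom_affine] on the line over [y], with the displacement [eps * (n.+1%:R * (L * l) + l)] of
    [elem_map_dist]; the 3 bounds [1 + A m m <= 9 / 4]. If the line misses the support box of [F],
    both terms vanish, because [phi] preserves the line. *)
Lemma bump_atom F (L : R) y : 1 <= L ->
  bump c (L * l) F -> bump c (L * l) (F \o phi) ->
  exists v, atom (c m ord0) (L * l) 3 (eps * (2 * (n.+1%:R * L + 1) + 2 * L) * l) v
    (fun t => F (insert m (t, y)) - A m m * F (phi (insert m (t, y)))).
Proof.
move=> L1 bF bFphi; have [a1 a2] := a34; have a0 : 0 < A m m by lra.
have [mF Fl Fr] := bF; have [_ _ Fpr] := bFphi.
have Ll0 : 0 <= L * l by rewrite mulr_ge0 ?(ltW l0)// (le_trans _ L1).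
have [yin|yout] := pselect (forall j, `|y j ord0 - c (lift m j) ord0| <= L * l).
  have [v Fv] := bump_insert m y bF.
  exists (fun t => v t + A m m * v (A m m * t + phi (insert m (0, y)) m ord0)).
  have -> : (fun t => F (insert m (t, y)) - A m m * F (phi (insert m (t, y)))) =
    (fun t => F (insert m (t, y)) -
      A m m * F (insert m (A m m * t + phi (insert m (0, y)) m ord0, y))).
    by apply/funext => t; rewrite elem_map_insert.
  apply: (@atom_le _ _ _ (1 + A m m) (2 * (eps * (n.+1%:R * (L * l) + l)) +
    eps * (2 * (L * l)))).
  - by lra.
  - by rewrite le_eqVlt; apply/orP; left; apply/eqP; ring.
  apply: (atom_affine (F := fun t => F (insert m (t, y)))) => //.
  - by apply: mulr_ge0 => //; apply: addr_ge0; [exact: mulr_ge0|exact: ltW].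
  - by move=> t /Fr /(_ m); rewrite insert_at.
  - by move=> t; rewrite -elem_map_insert => /Fpr /(_ m); rewrite insert_at.
  - by have := Aeps m; rewrite eqxx.
  - move=> t tr; have := @elem_map_dist (insert m (t, y)) (L * l).
    rewrite elem_map_insert !insert_at; apply => i.
    by case: (unliftP m i) => [j ->|->]; rewrite ?insert_lift ?insert_at.
have Fy0 t : F (insert m (t, y)) = 0.
  apply/eqP/negPn/negP => /Fr H; apply: yout => j.
  by have := H (lift m j); rewrite insert_lift.
exists (fun=> 0).
have -> : (fun t => F (insert m (t, y)) - A m m * F (phi (insert m (t, y)))) = fun=> 0.
  by apply/funext => t; rewrite elem_map_insert !Fy0 mulr0 subr0.
apply: atom0 => //; rewrite mulr_ge0 ?(ltW l0)// mulr_ge0//.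
have L0 : 0 <= L by exact: le_trans L1.
by rewrite addr_ge0 ?mulr_ge0// addr_ge0 ?mulr_ge0.
Qed.

End elementary_map.
End bumps.

(** * Induction on the number of nontrivial rows *)

Section triangular_induction.
Context {R : realType}.
Notation leb n := (@lebesgue R n).
Variable n : nat.
Implicit Types (A : 'M[R]_n.+1) (z c : 'cV[R]_n.+1) (F : 'cV[R]_n.+1 -> R).

Lemma bump_le c r r' F : r <= r' -> bump c r F -> bump c r' F.
Proof.
by move=> rr [mF Fl Fr]; split => // x Fx i; exact: le_trans (Fr x Fx i) rr.
Qed.

Definition near_id (m : nat) A z (eps l : R) :=
  [/\ forall i j, `|A i j - (i == j)%:R| <= eps,
      forall i, `|z i ord0| <= eps * l,
      forall i j : 'I_n.+1, (m <= i)%N -> A i j = (i == j)%:R &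
      forall i : 'I_n.+1, (m <= i)%N -> z i ord0 = 0].

Lemma near_id0 A z eps l : near_id 0 A z eps l -> A = 1%:M /\ z = 0.
Proof.
move=> [_ _ A1 z0]; split.
  by apply/matrixP => i j; rewrite mxE A1.
by apply/colP => i; rewrite mxE z0.
Qed.

Lemma near_id_pivot (m : 'I_n.+1) A z (eps l : R) : eps <= 1 / 2 -> 0 <= l ->
  near_id m.+1 A z eps l ->
  near_id m (pivot m A) (pivot_shift m A z) (2 * eps) l.
Proof.
move=> e2 l0 [Ae ze A1 z0]; split.
- exact: near_identity_pivot_mx.
- exact: near_identity_pivot_shift.
- by move=> i j; exact: pivot_trivial.
- by move=> i; exact: pivot_shift_trivial.
Qed.

Let eps_bound (m : nat) (eps : R) : 0 <= eps -> eps * 2 ^+ m * n.+2%:R <= 1 / 4 ->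
  eps * n.+2%:R <= 1 / 4 /\ eps <= 1 / 2.
Proof.
move=> e0 em.
have h1 : eps * n.+2%:R <= 1 / 4.
  apply: le_trans em; rewrite ler_wpM2r// -[leLHS]mulr1 ler_wpM2l//.
  by rewrite exprn_ege1// ler1n.
split => //; have : eps <= eps * n.+2%:R by rewrite -[leLHS]mulr1 ler_wpM2l// ler1n.
by lra.
Qed.

(** Each elementary factor at most doubles the support radius and has determinant at most [3 / 2].
    Elimination doubles [eps] while lowering [m] by one, so the hypothesis with [eps * 2 ^+ m] is
    inherited. *)
Lemma bump_aff (m : nat) A z c (eps l : R) F : (m <= n.+1)%N -> 0 <= eps -> 0 < l ->
  eps * 2 ^+ m * n.+2%:R <= 1 / 4 ->
  near_id m A z eps l -> bump c l F ->
  bump c (2 ^+ m * l) (F \o aff c A z) /\ `|\det A| <= 2 ^+ m.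
Proof.
elim: m A z eps => [|m IH] A z eps mn e0 l0 em nA bF.
  have [-> ->] := near_id0 nA; rewrite det1 normr1 expr0 mul1r; split; last exact: lexx.
  have -> : F \o aff c 1%:M 0 = F; last exact: bF.
  by apply/funext => x /=; rewrite /aff mul1mx addr0 addrC subrK.
have [en e2] := eps_bound e0 em.
pose mo := Ordinal mn.
have nA' : near_id mo (pivot mo A) (pivot_shift mo A z) (2 * eps) l.
  by apply: near_id_pivot => //; exact: ltW.
have e'0 : 0 <= 2 * eps by rewrite mulr_ge0.
have em' : 2 * eps * 2 ^+ m * n.+2%:R <= 1 / 4.
  by rewrite (mulrC 2) -(mulrA eps) -exprS.
have [bT' dT'] := IH _ _ _ (ltnW mn) e'0 l0 em' nA' bF.
have [Ae ze _ _] := nA.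
have a0 : A mo mo != 0.
  by have [h _] := near_identity_pivot mo e2 Ae; rewrite gt_eqF// (lt_le_trans _ h)// divr_gt0.
have TE : aff c A z = aff c (pivot mo A) (pivot_shift mo A z) \o
    aff c (elem_row mo A) (elem_shift mo z).
  by apply/funext => x; rewrite /= -aff_pivot.
split.
  rewrite TE exprS; apply: (bump_elem_map l0 en (Ae mo) (ze mo) _ bT').
  by rewrite exprn_ege1// ler1n.
rewrite -(pivot_mul a0) det_mulmx det_elem_row normrM exprS mulrC ler_pM//.
have [h1 h2] := near_identity_pivot mo e2 Ae.
by rewrite ger0_norm; lra.
Qed.

Lemma bump_sq_integrable c r F : 0 <= r -> bump c r F -> sq_integrable (leb n.+1) F.
Proof.
move=> r0 bF; have [mF _ Fr] := bF.
apply: (bounded_sq_integrable r0 mF (fun x => bump_norm x bF)) => x /Fr Fx i.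
exact: Fx.
Qed.

Definition grid_center N M (i : 'I_M * {ffun 'I_n.+1 -> 'I_M}) : 'cV[R]_n.+1 :=
  \col_m gcenter N i.1 (i.2 m).

(** Induction by [aff_pivot]: with [T = T' o phi], [F' = F o T'] and [a] the determinant of [phi],
    the difference is [(F - det A' * F') + det A' * (F' - a * F' o phi)]. The induction hypothesis
    controls the first part, [atomic_bessel] the second. [C] is chosen before [N] and [M], hence is
    uniform over all finite grids. *)
Lemma affine_bessel (m : nat) : (m <= n.+1)%N -> exists2 C : R, 0 <= C &
  forall (N M : nat) (eps : R) (A : 'I_M * {ffun 'I_n.+1 -> 'I_M} -> 'M[R]_n.+1)
    (z : 'I_M * {ffun 'I_n.+1 -> 'I_M} -> 'cV[R]_n.+1)
    (F : 'I_M * {ffun 'I_n.+1 -> 'I_M} -> 'cV[R]_n.+1 -> R)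
    (h : 'cV[R]_n.+1 -> R),
  0 <= eps -> eps * 2 ^+ m * n.+2%:R <= 1 / 4 ->
  (forall i, near_id m (A i) (z i) eps (scale N i.1)) ->
  (forall i, bump (grid_center N i) (scale N i.1) (F i)) ->
  sq_integrable (leb n.+1) h ->
  \sum_i (\int[leb n.+1]_x (h x * (F i x -
      \det (A i) * F i (aff (grid_center N i) (A i) (z i) x)))) ^+ 2 /
      scale N i.1 ^+ n.+1 <=
  C * eps * \int[leb n.+1]_x (h x ^+ 2).
Proof.
elim: m => [|m IH] mn.
  exists 0 => // N M eps A z F h e0 em nA bF hL.
  rewrite !mul0r big1// => i _; have [-> ->] := near_id0 (nA i).
  under eq_Rintegral => x _.
    rewrite det1 mul1r /aff mul1mx addr0 [_ + (x - _)]addrC subrK subrr mulr0.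
    over.
  by rewrite Rintegral_cst// mul0r expr0n mul0r.
have [C C0 HC] := IH (ltnW mn).
(* The support radius is at most [2 ^ m] scales for [F'] and twice that after the elementary map;
   [L] covers both. *)
pose L := (2 ^ m.+1)%N; pose mo := Ordinal mn.
pose kap : R := 2 * (n.+1%:R * L%:R + 1) + 2 * L%:R.
pose AC : R := atomic_const n L 3.
have AC0 : 0 <= AC by apply: atomic_const_ge0; rewrite ler1n.
have kap0 : 0 <= kap by rewrite /kap; do ![apply: addr_ge0|apply: mulr_ge0].
(* From [(X + d * Y) ^+ 2 <= 2 * X ^+ 2 + 2 * d ^+ 2 * Y ^+ 2] with [d ^+ 2 <= 4 ^+ m]; in [4 * C]
   this factor 2 meets the doubling of [eps] in the induction hypothesis. *)
exists (4 * C + 2 * 4 ^+ m * (AC * kap)).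
  apply: addr_ge0; first exact: mulr_ge0.
  by apply: mulr_ge0; [rewrite mulr_ge0 ?exprn_ge0|exact: mulr_ge0].
move=> N M eps A z F h e0 em nA bF hL.
have [en e2] := eps_bound e0 em.
set c := @grid_center N M; pose l i : R := scale N (i : 'I_M * {ffun 'I_n.+1 -> 'I_M}).1.
have l0 i : 0 < l i by exact: scale_gt0.
pose A' i := pivot mo (A i); pose z' i := pivot_shift mo (A i) (z i).
pose phi i := aff (c i) (elem_row mo (A i)) (elem_shift mo (z i)).
pose F' i := F i \o aff (c i) (A' i) (z' i).
have nA' i : near_id m (A' i) (z' i) (2 * eps) (l i).
  by apply: (@near_id_pivot mo) => //; exact: ltW.
have e'0 : 0 <= 2 * eps by rewrite mulr_ge0.
have em' : 2 * eps * 2 ^+ m * n.+2%:R <= 1 / 4.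
  by rewrite (mulrC 2) -(mulrA eps) -exprS.
have bF' i := bump_aff (ltnW mn) e'0 (l0 i) em' (nA' i) (bF i).
have a0 i : A i mo mo != 0.
  have [Ae _ _ _] := nA i; have [h0 _] := near_identity_pivot mo e2 Ae.
  by rewrite gt_eqF// (lt_le_trans _ h0)// divr_gt0.
have LE : L%:R = 2 * 2 ^+ m :> R by rewrite /L natrX exprS.
have L1 : 1 <= L%:R :> R by rewrite ler1n expn_gt0.
have bFL i : bump (c i) (L%:R * l i) (F' i).
  apply: bump_le (bF' i).1; apply: ler_wpM2r; first exact: ltW.
  by rewrite LE ler_peMl ?exprn_ge0// ler1n.
have bFphi i : bump (c i) (L%:R * l i) (F' i \o phi i).
  have [Ae ze _ _] := nA i; rewrite LE.
  apply: (bump_elem_map (l0 i) en (Ae mo) (ze mo) _ (bF' i).1).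
  by rewrite exprn_ege1// ler1n.
pose G i x := F' i x - A i mo mo * F' i (phi i x).
have G_atom : \sum_i (\int[leb n.+1]_x (h x * G i x)) ^+ 2 / l i ^+ n.+1 <=
    AC * (eps * kap) * \int[leb n.+1]_x (h x ^+ 2).
  apply: (@atomic_bessel R n N M L mo 3 (eps * kap) G).
  - by rewrite ler1n.
  - by rewrite mulr_ge0.
  - move=> i; have [mF' _ _] := bFL i; have [mF'phi _ _] := bFphi i.
    exact: (measurable_funB mF' (measurable_funM (measurable_cst _) mF'phi)).
  - move=> i y; have [Ae ze _ _] := nA i.
    have := bump_atom (l0 i) en (Ae mo) (ze mo) y L1 (bFL i) (bFphi i).
    by rewrite mxE.
  - move=> i t y Gne j; have [_ _ r1] := bFL i; have [_ _ r2] := bFphi i.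
    have [F0|/r1/(_ (lift mo j))] := eqVneq (F' i (insert mo (t, y))) 0.
      move: Gne; rewrite /G F0 sub0r oppr_eq0 mulf_eq0 negb_or => /andP[_].
      by move=> /r2/(_ (lift mo j)); rewrite insert_lift mxE.
    by rewrite insert_lift mxE.
  - exact: hL.
have U_bound := HC N M (2 * eps) A' z' F h e'0 em' nA' bF hL.
set H := \int[leb n.+1]_x (h x ^+ 2) in G_atom U_bound *.
pose U i x := F i x - \det (A' i) * F' i x.
have sqF i : sq_integrable (leb n.+1) (F i) by exact: bump_sq_integrable (ltW (l0 i)) (bF i).
have Ll0 i : 0 <= L%:R * l i by apply: mulr_ge0 => //; exact: ltW.
have sqF' i : sq_integrable (leb n.+1) (F' i) by exact: bump_sq_integrable (Ll0 i) (bFL i).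
have sqU i : sq_integrable (leb n.+1) (U i).
  exact: (sq_integrableB (sqF i) (sq_integrableZ _ (sqF' i))).
have sqG i : sq_integrable (leb n.+1) (G i).
  apply: (sq_integrableB (sqF' i)); apply: sq_integrableZ.
  exact: bump_sq_integrable (Ll0 i) (bFphi i).
have split_int i : \int[leb n.+1]_x (h x * (F i x -
      \det (A i) * F i (aff (c i) (A i) (z i) x))) =
    \int[leb n.+1]_x (h x * U i x) +
    \det (A' i) * \int[leb n.+1]_x (h x * G i x).
  have dG := integrableZl measurableT (\det (A' i)) (sq_integrableM hL (sqG i)).
  rewrite -RintegralZl//; last exact: sq_integrableM.
  rewrite -RintegralD//; last exact: sq_integrableM.
  apply: eq_Rintegral => x _; rewrite (aff_pivot (m := mo))//.
  rewrite -[in \det (A i)](pivot_mul (a0 i)) det_mulmx det_elem_row.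
  by rewrite /U /G /F' /=; ring.
have det_sq i : \det (A' i) ^+ 2 <= 4 ^+ m.
  rewrite -real_normK ?num_real// (_ : 4 = 2 ^+ 2) -?exprM 1?mulnC ?exprM; last first.
    by rewrite expr2 -natrM.
  by rewrite lerXn2r ?nnegrE ?exprn_ge0//; have [] := bF' i.
apply: (@le_trans _ _ (\sum_i (2 * ((\int[leb n.+1]_x (h x * U i x)) ^+ 2 / l i ^+ n.+1) +
    2 * 4 ^+ m * ((\int[leb n.+1]_x (h x * G i x)) ^+ 2 / l i ^+ n.+1)))).
  apply: ler_sum => i _; rewrite split_int mulrA [2 * 4 ^+ m * _]mulrA -mulrDl.
  apply: ler_wpM2r; first by rewrite invr_ge0 exprn_ge0 ?(ltW (l0 i)).
  set X := \int[leb n.+1]_x (h x * U i x); set Y := \int[leb n.+1]_x (h x * G i x).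
  have dY : \det (A' i) ^+ 2 * Y ^+ 2 <= 4 ^+ m * Y ^+ 2 by rewrite ler_wpM2r ?sqr_ge0.
  rewrite (_ : 2 * X ^+ 2 + _ = (X + \det (A' i) * Y) ^+ 2 +
    ((X - \det (A' i) * Y) ^+ 2 +
     2 * (4 ^+ m * Y ^+ 2 - \det (A' i) ^+ 2 * Y ^+ 2))); last by ring.
  by rewrite lerDl addr_ge0 ?sqr_ge0// mulr_ge0// subr_ge0.
rewrite big_split/= -!mulr_sumr.
have m0 : 0 <= 2 * 4 ^+ m :> R by rewrite mulr_ge0 ?exprn_ge0.
apply: (le_trans (lerD (ler_wpM2l (ler0n _ 2) U_bound) (ler_wpM2l m0 G_atom))).
by rewrite le_eqVlt; apply/orP; left; apply/eqP; ring.
Qed.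

End triangular_induction.

(** * Complex-valued functions and dyadic cubes *)

Section square_integrable_complex.
Context {R : realType}.
Notation leb n := (@lebesgue R n).
Variable n : nat.
Implicit Types f g : 'cV[R]_n -> R[i].

Lemma sqr_normc (z : R[i]) : normc z ^+ 2 = complex.Re z ^+ 2 + complex.Im z ^+ 2.
Proof. by case: z => a b /=; rewrite sqr_sqrtr// addr_ge0 ?sqr_ge0. Qed.

Lemma L2norm_sqr f : (L2norm f ^+ 2 =
  \int[leb n]_x (complex.Re (f x) ^+ 2 + complex.Im (f x) ^+ 2)%:E)%E.
Proof.
have : (L2norm f `^ 2 = \int[leb n]_x (`|(EFin \o @normc R \o f) x| `^ 2))%E.
  by rewrite /L2norm poweR_Lnorm.
have -> : (L2norm f `^ 2 = L2norm f ^+ 2)%E.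
  have := Lnorm_ge0 (leb n) 2%:E (EFin \o @normc R \o f); rewrite -/(L2norm f).
  case: (L2norm f) => [r| |]// r0; last by rewrite poweRyr// expe2 mulyy.
  by rewrite poweR_EFin powR_mulrn.
move=> ->; apply: eq_integral => x _ /=.
by rewrite ger0_norm ?normc_ge0// powR_mulrn ?normc_ge0// sqr_normc.
Qed.

Lemma L2_sq_integrable f : L2 f ->
  sq_integrable (leb n) (fun x => complex.Re (f x)) /\
  sq_integrable (leb n) (fun x => complex.Im (f x)).
Proof.
move=> [[mRe mIm] fin].
have mS : measurable_fun [set: lebesgue_space R n]
    (fun x => complex.Re (f x) ^+ 2 + complex.Im (f x) ^+ 2).
  by apply: measurable_funD; exact: measurable_funX.
have S0 x : 0 <= complex.Re (f x) ^+ 2 + complex.Im (f x) ^+ 2.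
  by rewrite addr_ge0 ?sqr_ge0.
have intS : (leb n).-integrable setT
    (EFin \o (fun x => complex.Re (f x) ^+ 2 + complex.Im (f x) ^+ 2)).
  apply/integrableP; split; first exact/measurable_EFinP.
  have -> : (\int[leb n]_x `|(complex.Re (f x) ^+ 2 + complex.Im (f x) ^+ 2)%:E| = L2norm f ^+ 2)%E.
    by rewrite L2norm_sqr; apply: eq_integral => x _ /=; rewrite ger0_norm.
  have := Lnorm_ge0 (leb n) 2%:E (EFin \o @normc R \o f); rewrite -/(L2norm f).
  by move: fin; case: (L2norm f) => // r _ _; rewrite expe2 -EFinM ltry.
split; split => //.
- apply: (le_integrable measurableT _ _ intS).
    by apply/measurable_EFinP; exact: measurable_funX.
  by move=> x _ /=; rewrite lee_fin !ger0_norm ?sqr_ge0// lerDl sqr_ge0.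
- apply: (le_integrable measurableT _ _ intS).
    by apply/measurable_EFinP; exact: measurable_funX.
  by move=> x _ /=; rewrite lee_fin !ger0_norm ?sqr_ge0// lerDr sqr_ge0.
Qed.

Lemma L2norm_Rintegral f : L2 f ->
  (L2norm f ^+ 2 = (\int[leb n]_x (complex.Re (f x) ^+ 2) +
                    \int[leb n]_x (complex.Im (f x) ^+ 2))%:E)%E.
Proof.
move=> fL; have [[_ iRe] [_ iIm]] := L2_sq_integrable fL.
rewrite L2norm_sqr -RintegralD// fineK//.
exact/integrable_fin_num/(integrableD measurableT iRe iIm).
Qed.

Lemma sq_integrable_L2 f :
  sq_integrable (leb n) (fun x => complex.Re (f x)) ->
  sq_integrable (leb n) (fun x => complex.Im (f x)) -> L2 f.
Proof.
move=> [mRe iRe] [mIm iIm]; split => //.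
have : (L2norm f ^+ 2 < +oo)%E.
  rewrite L2norm_sqr -ge0_fin_numE.
    exact/integrable_fin_num/(integrableD measurableT iRe iIm).
  by apply: integral_ge0 => x _; rewrite lee_fin addr_ge0 ?sqr_ge0.
have := Lnorm_ge0 (leb n) 2%:E (EFin \o @normc R \o f); rewrite -/(L2norm f).
by case: (L2norm f) => // r _ _; exact: ltry.
Qed.

(** Real and imaginary parts of the pairing have the form [a + b] and [c - e], and each square is at
    most twice the sum of the two squares. *)
Lemma sqr_normc_inner f g : L2 f -> L2 g ->
  normc (inner f g) ^+ 2 <=
  2 * ((\int[leb n]_x (complex.Re (f x) * complex.Re (g x))) ^+ 2 +
       (\int[leb n]_x (complex.Im (f x) * complex.Im (g x))) ^+ 2 +
       (\int[leb n]_x (complex.Im (f x) * complex.Re (g x))) ^+ 2 +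
       (\int[leb n]_x (complex.Re (f x) * complex.Im (g x))) ^+ 2).
Proof.
move=> fL gL; have [fRe fIm] := L2_sq_integrable fL; have [gRe gIm] := L2_sq_integrable gL.
rewrite sqr_normc /inner /cintegral /=.
have -> : \int[leb n]_x complex.Re (f x * conjc (g x)) =
    \int[leb n]_x (complex.Re (f x) * complex.Re (g x) +
                   complex.Im (f x) * complex.Im (g x)).
  by apply: eq_Rintegral => x _; case: (f x) => a b; case: (g x) => a' b' /=; ring.
have -> : \int[leb n]_x complex.Im (f x * conjc (g x)) =
    \int[leb n]_x (complex.Im (f x) * complex.Re (g x) -
                   complex.Re (f x) * complex.Im (g x)).
  by apply: eq_Rintegral => x _; case: (f x) => a b; case: (g x) => a' b' /=; ring.
rewrite RintegralD ?RintegralB//; try exact: sq_integrableM.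
set a := \int[_]_x _; set b := \int[_]_x _; set c := \int[_]_x _; set e := \int[_]_x _.
by have := sqr_ge0 (a - b); have := sqr_ge0 (c + e); nra.
Qed.

Lemma Re_mulr_real (z : R[i]) (r : R) : complex.Re (z * r%:C) = complex.Re z * r.
Proof. by case: z => a b /=; ring. Qed.

Lemma Im_mulr_real (z : R[i]) (r : R) : complex.Im (z * r%:C) = complex.Im z * r.
Proof. by case: z => a b /=; ring. Qed.

End square_integrable_complex.

Lemma ler_sum_subseq (R : numDomainType) (I : finType) (s : seq I) (F : I -> R) :
  uniq s -> (forall i, 0 <= F i) -> \sum_(i <- s) F i <= \sum_i F i.
Proof.
move=> us F0; rewrite big_uniq//= [leRHS](bigID (mem s))/= lerDl.
by apply: sumr_ge0.
Qed.

(** * Exhausting the dyadic cubes by finite grids *)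

Section grid.
Context {R : realType}.
Variable n : nat.
Notation grid_index M := ('I_M * {ffun 'I_n.+1 -> 'I_M})%type.

Definition grid_cube N M (i : grid_index M) : cube R n.+1 :=
  (\col_m (((i.2 m)%:R - N%:R) * scale N i.1), scale N i.1).

Lemma center_grid_cube N M (i : grid_index M) :
  Defs.center (grid_cube N i) = grid_center N i.
Proof. by apply/colP => m; rewrite !mxE /gcenter /side/=; field. Qed.

Lemma exprz_scale (N p : nat) (e : int) : e + N%:Z = p%:Z -> (2 : R) ^ e = scale N p.
Proof.
move=> eN; have -> : e = p%:Z - N%:Z by rewrite -eN addrK.
by rewrite expfzDr ?pnatr_eq0// -invr_expz.
Qed.

Lemma dyadic_grid_cube N M (i : grid_index M) : dyadic (grid_cube N i).
Proof.
move=> m; exists ((i.2 m : nat)%:Z - N%:Z), ((i.1 : nat)%:Z - N%:Z).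
rewrite (exprz_scale (p := i.1) (N := N)) ?subrK//.
rewrite /corner /side /= mxE !rmorphD rmorphN /= rmorph1.
by split => //; ring.
Qed.

(** [dyadic] provides one exponent per coordinate, but each power of 2 equals [side Q]; the exponent
    of coordinate 0 serves for all. *)
Lemma dyadic_grid_index (Q : cube R n.+1) : dyadic Q ->
  exists (e : int) (j : 'I_n.+1 -> int), side Q = 2 ^ e /\
    forall m, corner Q m ord0 = (j m)%:~R * 2 ^ e.
Proof.
move=> dQ.
have /boolp.choice[je H] : forall m, exists je : int * int,
    corner Q m ord0 = je.1%:~R * 2 ^ je.2 /\ side Q = 2 ^ je.2.
  move=> m; have [j [e [c1 c2]]] := dQ m; exists (j, e); split => //=.
  apply: (addrI (corner Q m ord0)); rewrite c2 c1 rmorphD /= rmorph1; ring.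
exists (je ord0).2, (fun m => (je m).1); split; first by have [] := H ord0.
by move=> m; have [_ <-] := H ord0; have [-> ->] := H m.
Qed.

(** Once [N] bounds the absolute values of [e] and of all [j m], the shifted integers [e + N] and
    [j m + N] lie between 0 and [2 * N]. Holding for all large [N], the claim extends to finitely
    many cubes at once. *)
Lemma dyadic_in_grid (Q : cube R n.+1) : dyadic Q -> exists N0, forall N,
  (N0 <= N)%N -> exists i : grid_index (2 * N).+1, grid_cube N i = Q.
Proof.
move=> /dyadic_grid_index[e [j [sQ cQ]]].
exists (maxn `|e|%N (\max_m `|j m|%N)) => N; rewrite geq_max => /andP[eN jN].
have jN' m : (`|j m|%N <= N)%N.
  by apply: leq_trans jN; exact: (@leq_bigmax _ (fun m => `|j m|%N)).
have eb : (absz (e + N%:Z)%R < (2 * N).+1)%N by lia.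
have jb m : (absz (j m + N%:Z)%R < (2 * N).+1)%N by have := jN' m; lia.
exists (Ordinal eb, [ffun m => Ordinal (jb m)]).
have sE : scale N (absz (e + N%:Z)%R) = 2 ^ e :> R.
  by rewrite -(@exprz_scale N _ e)//; lia.
case: Q sQ cQ => a s /= sQ cQ; rewrite /grid_cube /= sE; congr pair; last exact/esym.
apply/colP => m; rewrite mxE ffunE /= -[a m _]/(corner (a, s) m ord0) cQ.
congr (_ * _); have -> : j m = (absz (j m + N%:Z)%R)%:Z - N%:Z by have := jN' m; lia.
by rewrite rmorphB /=; congr (_%:R - _); lia.
Qed.

Lemma seq_dyadic_in_grid (s : seq (cube R n.+1)) :
  (forall Q, Q \in s -> dyadic Q) -> exists N, forall Q, Q \in s ->
  exists i : grid_index (2 * N).+1, grid_cube N i = Q.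
Proof.
move=> sd.
suff [N HN] : exists N0, forall N, (N0 <= N)%N -> forall Q, Q \in s ->
    exists i : grid_index (2 * N).+1, grid_cube N i = Q.
  by exists N; exact: HN.
elim: s sd => [|Q s IH] sd; first by exists 0.
have [|N1 H1] := IH.
  by move=> Q' Q's; apply: sd; rewrite inE Q's orbT.
have [N2 H2] := dyadic_in_grid (sd Q (mem_head _ _)).
exists (maxn N1 N2) => N; rewrite geq_max => /andP[n1 n2] Q'.
by rewrite inE => /predU1P[->|]; [exact: H2|exact: H1].
Qed.

(** The sum is a supremum over finite sets of dyadic cubes. Each such set embeds in one grid, whose
    additional cubes only add nonnegative terms. *)
Lemma esum_dyadic_le (t : cube R n.+1 -> R) (B : R) :
  (forall Q, 0 <= t Q) ->
  (forall N, \sum_(i : grid_index (2 * N).+1) t (grid_cube N i) <= B) ->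
  (\esum_(Q in dyadic) (t Q)%:E <= B%:E)%E.
Proof.
move=> t0 tB; apply: ge_ereal_sup => _ [X [finX Xd] <-].
rewrite fsbig_finite//= sumEFin lee_fin.
pose s : seq (cube R n.+1) := finmap.enum_fset (fset_set X).
have [Q|N HN] := @seq_dyadic_in_grid s.
  by rewrite -[_ \in s]/(Q \in fset_set X) in_fset_set// => /set_mem /Xd.
rewrite -[X in X <= _]/(\sum_(Q <- s) t Q).
have [i0 _] : exists i : grid_index (2 * N).+1, True.
  by exists (ord0, [ffun=> ord0]).
have /boolp.choice[g Hg] : forall Q, exists i : grid_index (2 * N).+1,
    Q \in s -> grid_cube N i = Q.
  move=> Q; have [/HN[i iQ]|_] := boolP (Q \in s); first by exists i.
  by exists i0.
apply: le_trans (tB N).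
rewrite (eq_big_seq (fun Q => t (grid_cube N (g Q)))); last by move=> Q /Hg ->.
rewrite -(big_map g xpredT (fun i => t (grid_cube N i))).
apply: ler_sum_subseq => //; rewrite map_inj_in_uniq ?finmap.fset_uniq//.
by move=> Q Q' /Hg {2}<- /Hg {2}<- ->.
Qed.

End grid.

(** * From the hypotheses on the family to near-identity maps and bumps *)

(** The translation is [A *m (l *: y)] because [tilde] shifts inside the matrix. Writing
    [A y = y + (A - 1) y] bounds its entries by [2 * eta * l], which is the origin of the 2. With
    [n.+1] nontrivial rows the last two conditions of [near_id] are vacuous. *)
Lemma near_id_of_norm (R : realType) (n : nat) (A : 'M[R]_n.+1) (y : 'cV[R]_n.+1)
    (eta l : R) : eta <= 1 -> 0 <= l ->
  mx_norm_inf (A - 1%:M) + `|y| <= eta ->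
  near_id n.+1 A (A *m (l *: y)) (2 * eta) l.
Proof.
move=> eta1 l0 Ay.
have y0 : 0 <= `|y| by [].
have rowsum i : \sum_j `|(A - 1%:M) i j| <= mx_norm_inf (A - 1%:M).
  by rewrite /mx_norm_inf; apply: le_bigmax.
have N0 : 0 <= mx_norm_inf (A - 1%:M).
  by apply: le_trans (rowsum ord0); apply: sumr_ge0.
have eta0 : 0 <= eta by apply: le_trans Ay; rewrite addr_ge0.
have Aeta i j : `|A i j - (i == j)%:R| <= eta.
  apply: (@le_trans _ _ (mx_norm_inf (A - 1%:M))); last by move: Ay; lra.
  apply: le_trans (rowsum i); rewrite (bigD1 j)//= !mxE lerDl.
  by apply: sumr_ge0.
have yeta j : `|y j ord0| <= eta.
  apply: (@le_trans _ _ `|y|); last by move: Ay; lra.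
  rewrite [leRHS]/Num.norm /= mx_normrE.
  exact: (le_bigmax _ (fun ij : 'I_n.+1 * 'I_1 => `|y ij.1 ij.2|) (j, ord0)).
split.
- by move=> i j; rewrite (le_trans (Aeta i j))// ler_peMl// ler1n.
- move=> i; rewrite -scalemxAr mxE normrM (ger0_norm l0) mulrC ler_wpM2r//.
  rewrite mxE (eq_bigr (fun j => (A - 1%:M) i j * y j ord0 + (i == j)%:R * y j ord0)).
    rewrite big_split/= (le_trans (ler_normD _ _))// mulrDl mul1r lerD//.
      rewrite (le_trans (ler_norm_sum _ _ _))//.
      apply: (@le_trans _ _ (\sum_j `|(A - 1%:M) i j| * eta)).
        by apply: ler_sum => j _; rewrite normrM ler_wpM2l.
      rewrite -mulr_suml ler_piMl// (le_trans (rowsum i))//.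
      by move: Ay; lra.
    rewrite (bigD1 i)//= eqxx mul1r big1 ?addr0// => j ij.
    by rewrite eq_sym (negbTE ij) mul0r.
  by move=> j _; rewrite !mxE; ring.
- by move=> i j; rewrite ltn_geF.
- by move=> i; rewrite ltn_geF.
Qed.

Section snbv_bumps.
Context {R : realType}.
Variable n : nat.
Implicit Types f : 'cV[R]_n.+1 -> R[i].

Lemma SNBV_on_support N M (i : 'I_M * {ffun 'I_n.+1 -> 'I_M}) f x :
  SNBV_on (grid_cube N i) f -> f x != 0 ->
  forall m, `|x m ord0 - @grid_center R n N M i m ord0| <= scale N i.1.
Proof.
move=> [_ fQ] /fQ /= xQ m; have := xQ m; rewrite in_itv/= => /andP[x1 x2].
rewrite -center_grid_cube !mxE; move: x1 x2; rewrite /corner /side /= mxE.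
have := @scale_gt0 R N i.1 => s0 x1 x2.
by rewrite ler_distl; apply/andP; split; lra.
Qed.

Lemma SNBV_on_bump N M (i : 'I_M * {ffun 'I_n.+1 -> 'I_M}) f :
  SNBV_on (grid_cube N i) f ->
  bump (grid_center N i) (scale N i.1) (fun x => complex.Re (f x)) /\
  bump (grid_center N i) (scale N i.1) (fun x => complex.Im (f x)).
Proof.
move=> fQ; have [[[mRe mIm] tv] _] := fQ; split; split => //.
- by move=> v y; have [w] := total_variationC_Re (tv v y); exists w.
- move=> x Rex; apply: SNBV_on_support fQ _.
  by apply: contraNneq Rex => ->.
- by move=> v y; have [w] := total_variationC_Im (tv v y); exists w.
- move=> x Imx; apply: SNBV_on_support fQ _.
  by apply: contraNneq Imx => ->.
Qed.

End snbv_bumps.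

Theorem theorem5 (R : realType) (d : nat) (hd : (1 <= d)%N) :
  exists c C : R, [/\ 0 < c, 0 < C &
    forall (eta : R) (f : cube R d -> 'cV[R]_d -> R[i])
           (A : cube R d -> 'M[R]_d) (y : cube R d -> 'cV[R]_d),
      0 <= eta <= c ->
      (forall Q, dyadic Q -> SNBV_on Q (f Q)) ->
      (forall Q, dyadic Q -> mx_norm_inf (A Q - 1%:M) + `|y Q| <= eta) ->
      let psi (Q : cube R d) (x : 'cV[R]_d) : R[i] :=
        (f Q x - (\det (A Q))%:C * tilde Q (A Q) (y Q) (f Q) x)
          / (Num.sqrt (volume Q))%:C in
      bessel dyadic psi /\ AO_norm dyadic psi <= C * Num.sqrt eta].
Proof.
case: d hd => // n _.
have [C C0 HC] := @affine_bessel R n n.+1 (leqnn _).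
(* [eta <= K^-1] is exactly the smallness condition of [affine_bessel] for the deviation [2 * eta]
   and [n.+1] rows. *)
pose K : R := 8 * 2 ^+ n.+1 * n.+2%:R.
have K0 : 0 < K by rewrite !mulr_gt0// exprn_gt0.
(* The [+ 1] secures positivity, [C] being only known to be nonnegative. *)
exists K^-1, (Num.sqrt (8 * C + 1)); split.
- by rewrite invr_gt0.
- by rewrite sqrtr_gt0 ltr_wpDl ?mulr_ge0.
move=> eta f A y /andP[eta0 etac] fS Ay psi.
have etaK : eta * K <= 1 by rewrite -ler_pdivlMr// div1r.
have em : 2 * eta * 2 ^+ n.+1 * n.+2%:R <= 1 / 4.
  by move: etaK; rewrite /K => etaK; lra.
have eta1 : eta <= 1.
  apply: le_trans etaK; rewrite -[leLHS]mulr1 ler_wpM2l// /K.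
  by rewrite -[leLHS]mulr1 ler_pM ?ler1n// -[leLHS]mulr1 ler_pM ?ler1n ?exprn_ege1 ?ler1n.
have e0 : 0 <= 2 * eta by rewrite mulr_ge0.
pose D N := @grid_cube R n N (2 * N).+1.
pose z N i := A (D N i) *m (scale N i.1 *: y (D N i)).
have nA N i : near_id n.+1 (A (D N i)) (z N i) (2 * eta) (scale N i.1).
  apply: near_id_of_norm => //; first exact/ltW/scale_gt0.
  by apply: Ay; exact: dyadic_grid_cube.
pose lam N (i : 'I_(2 * N).+1 * {ffun 'I_n.+1 -> 'I_(2 * N).+1}) : R :=
  (Num.sqrt (scale N i.1 ^+ n.+1))^-1.
pose diff N i (F : 'cV[R]_n.+1 -> R) x :=
  F x - \det (A (D N i)) * F (aff (grid_center N i) (A (D N i)) (z N i) x).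
have psiE N i x : psi (D N i) x = (f (D N i) x - (\det (A (D N i)))%:C *
    f (D N i) (aff (grid_center N i) (A (D N i)) (z N i) x)) * (lam N i)%:C.
  rewrite /psi volumeE; last exact: scale_gt0.
  rewrite /lam fmorphV /=; congr ((_ - _ * f _ _) / _).
  rewrite /aff center_grid_cube -[RHS]addrA; congr (_ + _).
  by rewrite /z -mulmxDr; congr (_ *m _); rewrite [RHS]addrC addrA.
have psiRe N i x : complex.Re (psi (D N i) x) =
    lam N i * diff N i (fun x => complex.Re (f (D N i) x)) x.
  rewrite psiE Re_mulr_real mulrC; congr (_ * _); rewrite /diff.
  by case: (f _ x) => a b; case: (f _ _) => a' b' /=; ring.
have psiIm N i x : complex.Im (psi (D N i) x) =
    lam N i * diff N i (fun x => complex.Im (f (D N i) x)) x.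
  rewrite psiE Im_mulr_real mulrC; congr (_ * _); rewrite /diff.
  by case: (f _ x) => a b; case: (f _ _) => a' b' /=; ring.
have sq_diff N i F : bump (grid_center N i) (scale N i.1) F ->
    sq_integrable (@lebesgue R n.+1) (diff N i F).
  move=> bF; have s0 := @scale_gt0 R N i.1.
  have [bFT _] := bump_aff (leqnn _) e0 s0 em (nA N i) bF.
  apply: sq_integrableB; first exact: bump_sq_integrable (ltW s0) bF.
  apply: sq_integrableZ; apply: bump_sq_integrable bFT.
  by rewrite mulr_ge0 ?exprn_ge0// ltW.
have bound N (F : _ -> 'cV[R]_n.+1 -> R) h :
    (forall i, bump (grid_center N i) (scale N i.1) (F i)) ->
    sq_integrable (@lebesgue R n.+1) h ->
    \sum_i (\int[@lebesgue R n.+1]_x (h x * (lam N i * diff N i (F i) x))) ^+ 2 <=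
    C * (2 * eta) * \int[@lebesgue R n.+1]_x (h x ^+ 2).
  move=> bF hL; have := HC N _ _ (fun i => A (D N i)) (z N) F h e0 em (nA N) bF hL.
  apply: le_trans; rewrite le_eqVlt; apply/orP; left; apply/eqP.
  apply: eq_bigr => i _.
  under eq_Rintegral do rewrite mulrCA.
  rewrite RintegralZl//; last exact: sq_integrableM (sq_diff _ _ _ (bF i)).
  rewrite exprMn /lam exprVn sqr_sqrtr; first by rewrite mulrC.
  by rewrite exprn_ge0// ltW// scale_gt0.
have bRe N i : bump (grid_center N i) (scale N i.1)
    (fun x => complex.Re (f (D N i) x)).
  exact: (SNBV_on_bump (fS _ (dyadic_grid_cube N i))).1.
have bIm N i : bump (grid_center N i) (scale N i.1)
    (fun x => complex.Im (f (D N i) x)).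
  exact: (SNBV_on_bump (fS _ (dyadic_grid_cube N i))).2.
have psiL2 Q : dyadic Q -> L2 (psi Q).
  move=> /dyadic_in_grid[N /(_ N (leqnn _))[i <-]].
  apply: sq_integrable_L2.
  - under eq_fun do rewrite psiRe.
    by apply: sq_integrableZ; apply: sq_diff; exact: bRe.
  - under eq_fun do rewrite psiIm.
    by apply: sq_integrableZ; apply: sq_diff; exact: bIm.
(* The 8 is a product of three factors 2: the one in [sqr_normc_inner], the one in [2 * eta], and
   one because each of the real and imaginary parts of [h] is paired with two real families. *)
have BB : bessel_bound dyadic psi (8 * C * eta).
  split; first by rewrite !mulr_ge0.
  move=> h hL; have [hRe hIm] := L2_sq_integrable hL.
  rewrite L2norm_Rintegral// -EFinM; apply: esum_dyadic_le => [Q|N].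
    exact: sqr_ge0.
  set HR := \int[@lebesgue R n.+1]_x (complex.Re (h x) ^+ 2).
  set HI := \int[@lebesgue R n.+1]_x (complex.Im (h x) ^+ 2).
  have bRR := bound N _ _ (bRe N) hRe; have bRI := bound N _ _ (bIm N) hRe.
  have bIR := bound N _ _ (bRe N) hIm; have bII := bound N _ _ (bIm N) hIm.
  rewrite -/HR -/HI in bRR bRI bIR bII.
  apply: le_trans.
    apply: ler_sum => i _; apply: (sqr_normc_inner hL).
    by apply: psiL2; exact: dyadic_grid_cube.
  rewrite -mulr_sumr !big_split/=.
  under eq_bigr do under eq_Rintegral do rewrite psiRe.
  under [X in _ * (_ + X + _ + _)]eq_bigr do under eq_Rintegral do rewrite psiIm.
  under [X in _ * (_ + _ + X + _)]eq_bigr do under eq_Rintegral do rewrite psiRe.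
  under [X in _ * (_ + _ + _ + X)]eq_bigr do under eq_Rintegral do rewrite psiIm.
  by lra.
split; first by split => //; exists (8 * C * eta).
rewrite /AO_norm -sqrtrM ?addr_ge0 ?mulr_ge0// ler_wsqrtr//.
apply: (@le_trans _ _ (8 * C * eta)).
  by apply: ge_inf => //; exists 0 => B [].
by rewrite ler_wpM2r// lerDl.
Qed.
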